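(* Let $X=(X_n)_{n\in\mathbb{Z}}$ be an i.i.d. sequence of random variables with values in $\{-1,0,1,2,\dots\}$ with $0<\mathbb{P}[X_0=-1]\le1$ and $0<\mathbb{E}[X_0]\le\infty$. Let $S_0=0$, $S_n=\sum_{k=0}^{n-1}X_k$ for $n>0$, let $\eta_{-1}=\inf\{n\ge0:S_n=-1\}$ (with $\inf\emptyset=\infty$) and $c=\mathbb{P}[\eta_{-1}<\infty]$. Define distributions on $\{0,1,2,\dots\}$ by $\tilde\pi(k)=c^{k-1}\mathbb{P}[X_0=k-1]$ and $\bar\pi(k)=\mathbb{P}[X_0\ge k]c^k$. Let $[\mathbf{T},0]$ be the connected component of $0$ in the record graph of $X$, rooted at $0$, viewed as an ordered Family Tree with children ordered by the order of $\mathbb{Z}$. Then $[\mathbf{T},0]$ has the distribution of the unimodularised ECS ordered bi-variate Eternal Kesten Tree $EKT(\bar\pi,\tilde\pi)$.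
   Context: For a sequence $x=(x_n)_{n\in\mathbb{Z}}$ write $y(j,k)=\sum_{l=j}^{k-1}x_l$ for $j<k$. The record map is $R_x(i)=\inf\{n>i: y(i,n)\ge0\}$ if this set is nonempty, and $R_x(i)=i$ otherwise. The record graph has vertex set $\mathbb{Z}$ and a directed edge $i\to R_x(i)$ (child to parent) whenever $R_x(i)\ne i$; components are taken in the undirected sense. A Family Tree is a directed tree in which every vertex has out-degree at most one; it is ordered if the children of every vertex are totally ordered. $GW(\beta)$ denotes an ordered Galton-Watson tree with offspring distribution $\beta$. Unimodularised ECS ordered $EKT(\alpha,\beta)$ (for $\alpha,\beta$ on $\{0,1,\dots\}$ with $m(\alpha)<\infty$, $m(\beta)<1$): let $([\mathbf{T}_i,\mathbf{o}_i])_{i\in\mathbb{Z}}$ be i.i.d. ordered Family Trees, where in each $\mathbf{T}_i$ the root $\mathbf{o}_i$ has an $\alpha$-distributed number of children whose descendant trees are i.i.d. $GW(\beta)$, independent of that number. Form the Eternal Family Tree $\mathbf{T}'$ by adding the directed edges $\mathbf{o}_i\to\mathbf{o}_{i+1}$ for all $i$; order it so that $\mathbf{o}_i$ is the smallest among the children of $\mathbf{o}_{i+1}$ and the remaining children of $\mathbf{o}_{i+1}$ (those in $\mathbf{T}_{i+1}$) are in uniform random order (ECS order). The unimodularised version is the law $\mathcal{P}'$ on rooted ordered trees given by $\mathcal{P}'[A]=\mathbb{E}\big[\sum_{v\in V(\mathbf{T}_0)}\mathbf{1}_A([\mathbf{T}',v])\big]/\mathbb{E}[\#V(\mathbf{T}_0)]$.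 *)

(* Defs.v *)
From HB Require Import structures.
From mathcomp Require Import all_boot all_order all_algebra.
From mathcomp Require Import all_classical all_reals all_analysis.
Set Implicit Arguments. Unset Strict Implicit. Unset Printing Implicit Defensive.
Import Order.TTheory GRing.Theory Num.Theory.
Local Open Scope classical_set_scope.
Local Open Scope ring_scope.

(* A (possibly infinite) ordered Family Tree on vertex type V is given by the
   child-to-parent relation [pr u v] ("v is the parent of u", out-degree <= 1)
   and a strict order [lt] between siblings (children of a common vertex). *)

Definition adj (V : Type) (pr : V -> V -> Prop) (u v : V) : Prop :=
  pr u v \/ pr v u.

Fixpoint within (V : Type) (pr : V -> V -> Prop) (r : nat) (u v : V) : Prop :=
  match r with
  | 0 => u = v
  | r'.+1 => u = v \/ exists w, adj pr u w /\ within pr r' w v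
  end.

Record fshape (n : nat) := FShape {
  fpar : 'I_n -> option 'I_n;
  flt : 'I_n -> 'I_n -> bool;
  froot : 'I_n }.

Definition ball_iso (V : Type) (pr lt : V -> V -> Prop) (r : nat) (root : V)
    (n : nat) (F : fshape n) : Prop :=
  exists f : 'I_n -> V,
    [/\ injective f, f (froot F) = root,
        (forall v, within pr r root v <-> exists i, f i = v),
        (forall i j, fpar F i = Some j <-> pr (f i) (f j)) &
        (forall i j, flt F i j <-> lt (f i) (f j))].

(* y(j,k) = sum_{l=j}^{k-1} x_l  (used for j < k) *)
Definition ysum (x : int -> int) (j k : int) : int :=
  \sum_(0 <= l < absz (k - j)) x (j + l%:Z).

(* child-to-parent edge i -> R_x(i) = j, present iff R_x(i) <> i, i.e.
   j is the least n > i with y(i,n) >= 0. *)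
Definition recpr (x : int -> int) (i j : int) : Prop :=
  [/\ i < j, 0 <= ysum x i j &
      forall n, i < n -> n < j -> ysum x i n < 0].

Definition reclt (x : int -> int) (u v : int) : Prop :=
  exists p, [/\ recpr x u p, recpr x v p & u < v].

Inductive ptree := Node of seq ptree.

Definition leaf := Node [::].

Definition children (t : ptree) : seq ptree := let: Node ts := t in ts.

Fixpoint gw_law (R : realType) (beta : nat -> R) (t : ptree) {struct t} : R :=
  let: Node ts := t in
  beta (size ts) *
  (fix pl (l : seq ptree) : R :=
     if l is u :: l' then gw_law beta u * pl l' else 1) ts.

(* law of the tree T_i: root has alpha-distributed number of children, whose
   descendant trees are i.i.d. GW(beta) independent of that number.
   (Reordering the root's children uniformly at random, as in the ECS order,
   does not change this law, since the product is symmetric.) *)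
Definition ekt_root_law (R : realType) (alpha beta : nat -> R) (t : ptree) : R :=
  let: Node ts := t in
  alpha (size ts) * \prod_(u <- ts) gw_law beta u.

(* Ulam-Harris addresses: [k :: a] = the a-descendant of the k-th child *)
Fixpoint valid (t : ptree) (a : seq nat) {struct a} : bool :=
  match a with
  | [::] => true
  | k :: a' => (k < size (children t))%N && valid (nth leaf (children t) k) a'
  end.

Fixpoint addrs (t : ptree) {struct t} : seq (seq nat) :=
  let: Node ts := t in
  [::] :: (fix go (k : nat) (l : seq ptree) : seq (seq nat) :=
             if l is u :: l' then map (cons k) (addrs u) ++ go k.+1 l' else [::])
          0%N ts.

(* vertices: (i, a) with a a valid address in T_i; o_i = (i, [::]). *)
Definition ektpr (tr : int -> ptree) (u v : int * seq nat) : Prop :=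
  valid (tr u.1) u.2 /\
  ((exists b k, u.2 = rcons b k /\ v = (u.1, b)) \/
   (u.2 = [::] /\ v = (u.1 + 1, [::]))).

(* ECS order key: o_i is the smallest child of o_{i+1}; the other children
   keep the plane order of T_{i+1}. *)
Definition ektkey (u : int * seq nat) : nat :=
  if u.2 is [::] then 0%N else (last 0%N u.2).+1.

Definition ektlt (tr : int -> ptree) (u v : int * seq nat) : Prop :=
  exists p, [/\ ektpr tr u p, ektpr tr v p & (ektkey u < ektkey v)%N].

Section Dists.
Local Open Scope ereal_scope.
Context (R : realType) (d : measure_display) (Omega : measurableType d)
  (P : probability Omega R) (X : int -> Omega -> int).

Definition c_hit : R :=
  fine (P [set w : Omega | exists n : nat,
    (\sum_(0 <= k < n) X (Posz k) w)%R = (-1)%R]).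

Definition pitilde (k : nat) : R :=
  (c_hit ^ (k%:Z - 1) * fine (P [set w | X 0 w = (k%:Z - 1)%R]))%R.

Definition pibar (k : nat) : R :=
  (fine (P [set w | (k%:Z <= X 0 w)%R]) * c_hit ^+ k)%R.
End Dists.

(* Main.v *)
Require Import Defs.
From HB Require Import structures.
From mathcomp Require Import all_boot all_order all_algebra zify ring lra.
From mathcomp Require Import all_classical all_reals all_analysis
  measurable_realfun.
Import Order.TTheory GRing.Theory Num.Theory.
Local Open Scope classical_set_scope.
Local Open Scope ring_scope.

(** Call [p] a spine point if y(l,p) >= 0 for all l < p, that is, if the path
    with increments x is at a weak record at p, and read x backwards.  A
    non-spine vertex v with k children has x(v-1) = k - 1, and its descendants
    are encoded by a backward Lukasiewicz excursion; a spine point p has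
    x(p-1) >= k where k counts its children that are not spine points, and
    after the k corresponding excursions one arrives at the previous spine
    point.  So, reading down from a spine point, the successive bushes have the
    law of the trees T_i, the powers of c telescoping along the excursions,
    and every given point is a spine point with the same probability q.  The
    events that 0 is the vertex of address a in the middle one of 2r + 3 given
    consecutive bushes are disjoint, have probability q times the law of the
    bushes, and on each of them the r-ball of the record graph around 0 is the
    r-ball of T' around (0, a).  Summing gives the theorem once these events
    are known to cover: positive drift yields, by a Chernoff bound, a spine
    point above 0, the total mass of the law of T_0 shows that its bush can
    almost surely be decoded, and the number of bushes in the window does not
    change the total mass q E[#V(T_0)], which is hence 1. *)

Set Implicit Arguments.
Unset Strict Implicit.
Unset Printing Implicit Defensive.

(** * Plane trees and their backward exploration *)

(** Membership is [List.In] because [ptree] has no decidable equality at this point. *)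
Lemma ptree_nested_ind (S : ptree -> Prop) :
  (forall ts, (forall u, List.In u ts -> S u) -> S (Node ts)) -> forall t, S t.
Proof.
move=> H; fix IH 1; case=> ts; apply: H.
elim: ts => [|u ts IHts] v /=; first by case.
by case=> [<-|]; [exact: IH|exact: IHts].
Qed.

Fixpoint ptree_encode (t : ptree) : GenTree.tree unit :=
  let: Node ts := t in GenTree.Node 0 (map ptree_encode ts).

Fixpoint ptree_decode (t : GenTree.tree unit) : ptree :=
  if t is GenTree.Node _ ts then Node (map ptree_decode ts) else leaf.

Lemma ptree_encodeK : cancel ptree_encode ptree_decode.
Proof.
elim/ptree_nested_ind => ts IH /=; congr Node; rewrite -map_comp.
elim: ts IH => //= u ts IHts IH; congr cons; first by apply: IH; left.
by apply: IHts => v vts; apply: IH; right.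
Qed.

HB.instance Definition _ := Countable.copy ptree (can_type ptree_encodeK).

Fixpoint nverts (t : ptree) : nat :=
  let: Node ts := t in (sumn (map nverts ts)).+1.

Definition fverts (ts : seq ptree) : nat := sumn (map nverts ts).

Lemma nverts_gt0 t : (0 < nverts t)%N. Proof. by case: t. Qed.

(* Number of vertices visited strictly before the vertex of address [a] when
   the tree is explored from the root, last child first. *)
Fixpoint offset (t : ptree) (a : seq nat) : nat :=
  if a is k :: a' then
    (1 + fverts (drop k.+1 (children t)) +
       offset (nth leaf (children t) k) a')%N
  else 0%N.

Lemma fverts_cons u ts : fverts (u :: ts) = (nverts u + fverts ts)%N.
Proof. by []. Qed.

Lemma fverts_drop ts k : (k < size ts)%N ->
  (fverts (drop k.+1 ts) + nverts (nth leaf ts k) <= fverts ts)%N.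
Proof.
elim: ts k => //= u ts IH [|k]; rewrite fverts_cons ?drop0 ?ltnS /=; first lia.
by move=> /IH; lia.
Qed.

Lemma fverts_drop_lt ts k k' : (k < k')%N -> (k' < size ts)%N ->
  (fverts (drop k'.+1 ts) + nverts (nth leaf ts k') <= fverts (drop k.+1 ts))%N.
Proof.
elim: ts k k' => //= u ts IH [|k] [|k'] //; rewrite !ltnS.
  by move=> _ kts; rewrite drop0; exact: fverts_drop.
by move=> kk' kts; exact: IH.
Qed.

Lemma offset_lt t a : valid t a -> (offset t a < nverts t)%N.
Proof.
elim: a t => [|k a IH] [ts] //= /andP[kts va].
by have := IH _ va; have := fverts_drop kts; rewrite /fverts; lia.
Qed.

(** The subtrees of the children of a vertex occupy disjoint intervals of offsets, later children
    first, so the offset determines the child and then, recursively, the address. *)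
Lemma offset_inj t a b : valid t a -> valid t b ->
  offset t a = offset t b -> a = b.
Proof.
elim: a t b => [|k a IH] [ts] [|l b] //= /andP[kts va] /andP[lts vb] E.
have ha := offset_lt va; have hb := offset_lt vb.
have kl : k = l.
  case: (ltngtP k l) => // /fverts_drop_lt.
  - by move=> /(_ _ lts); lia.
  - by move=> /(_ _ kts); lia.
by subst l; congr cons; apply: (IH _ _ va vb); lia.
Qed.

Lemma fverts_locate ts m : (m < fverts ts)%N ->
  exists k m', [/\ (k < size ts)%N, (m' < nverts (nth leaf ts k))%N &
    m = (fverts (drop k.+1 ts) + m')%N].
Proof.
elim: ts => //= u ts IH; rewrite fverts_cons => mlt.
have [/IH [k [m' [kts m'lt ->]]]|hge] := ltnP m (fverts ts).
  by exists k.+1, m'.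
by exists 0%N, (m - fverts ts)%N; rewrite /= drop0; split=> //; lia.
Qed.

Lemma offset_surj t m : (m < nverts t)%N ->
  exists2 a, valid t a & offset t a = m.
Proof.
elim/ptree_nested_ind: t m => ts IH [|m] mlt; first by exists [::].
have [k [m' [kts m'lt ->]]] := fverts_locate (mlt : (m < fverts ts)%N).
have In_nth : List.In (nth leaf ts k) ts.
  by elim: ts k kts {IH mlt m'lt} => //= u ts IHts [|k] kts; [left|right; exact: IHts].
have [a va am] := IH _ In_nth _ m'lt.
by exists (k :: a); rewrite /= ?kts // am; lia.
Qed.

Lemma offset_rcons t b k : valid t (rcons b k) ->
  valid t b /\ (offset t b < offset t (rcons b k))%N.
Proof.
elim: b t => [|l b IH] [ts] //= /andP[-> /IH[-> lt]]; split=> //; lia.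
Qed.

Lemma offset_sibling t b k k' : valid t (rcons b k') -> (k < k')%N ->
  (offset t (rcons b k') < offset t (rcons b k))%N.
Proof.
elim: b t => [|l b IH] [ts] /=.
  rewrite andbT => kts kk'; have := fverts_drop_lt kk' kts.
  by have := nverts_gt0 (nth leaf ts k'); lia.
by move=> /andP[_ /IH h] /h; lia.
Qed.

Lemma addrs_cons ts : addrs (Node ts) = [::] ::
  flatten [seq map (cons k) (addrs (nth leaf ts k)) | k <- iota 0 (size ts)].
Proof.
rewrite /=; congr cons; rewrite -[X in iota X]/(0)%N.
pose F (ts : seq ptree) j := (fix go (k : nat) (l : seq ptree) : seq (seq nat) :=
  if l is u :: l' then map (cons k) (addrs u) ++ go k.+1 l' else [::]) j ts.
rewrite -/(F ts 0%N).
suff: forall j, F ts j =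
    flatten [seq map (cons (j + k)%N) (addrs (nth leaf ts k)) | k <- iota 0 (size ts)].
  by move=> ->; congr flatten; apply: eq_map => k; rewrite add0n.
elim: ts => //= u ts IH j; rewrite addn0; congr cat; rewrite IH.
congr flatten; rewrite (iotaDl 1 0) -map_comp.
by apply: eq_map => k /=; rewrite add1n addSnnS.
Qed.

Lemma mem_addrs t a : (a \in addrs t) = valid t a.
Proof.
elim: a t => [|k a IH] [ts]; rewrite addrs_cons // in_cons /=.
apply/flatten_mapP/andP => [[l]|[kts va]].
  rewrite mem_iota /= add0n => lts /mapP[b vb [-> ab]].
  by rewrite -IH ab.
exists k; first by rewrite mem_iota.
by apply/mapP; exists a; rewrite // IH.
Qed.

Lemma addrs_uniq t : uniq (addrs t).
Proof.
elim/ptree_nested_ind: t => ts IH; rewrite addrs_cons cons_uniq.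
apply/andP; split; first by apply/flatten_mapP => -[k _ /mapP[]].
have {}IH k : (k < size ts)%N -> uniq (addrs (nth leaf ts k)).
  move=> kts; apply: IH; elim: ts k kts => //= u ts IHts [|k] kts; first by left.
  by right; exact: IHts.
(* Stated so that the induction can shrink the left list while the right one keeps the bound
   [size ts] required by [IH]. *)
have : {subset iota 0 (size ts) <= iota 0 (size ts)} by [].
have : uniq (iota 0 (size ts)) by exact: iota_uniq.
elim: {1 2 4}(iota 0 (size ts)) => //= k s IHs /andP[ks us] sub.
have kts : (k < size ts)%N by have := sub k (mem_head _ _); rewrite mem_iota.
rewrite cat_uniq map_inj_uniq ?(IH _ kts) /=; last by move=> b c [].
rewrite IHs // ?andbT => [|l ls]; last by apply: sub; rewrite in_cons ls orbT.
apply/hasPn => b /flatten_mapP[l ls /mapP[b' _ ->]].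
by apply/mapP => -[c _ [E _]]; move: ks; rewrite -E ls.
Qed.

(** * Height function and Lukasiewicz words *)

(* A primitive of [x], so that [y(j,k) = height k - height j]. *)
Definition height (x : int -> int) (n : int) : int :=
  if n is Posz m then \sum_(0 <= l < m) x l%:Z
  else - \sum_(0 <= l < `|n|) x (n + l%:Z).

Lemma heightS x (n : int) : height x (n + 1) = height x n + x n.
Proof.
case: n => n; first by rewrite /height -PoszD addn1 big_nat_recr.
case: n => [|n]; first by rewrite /height /= big_nil big_nat1 addr0 addNr.
have -> : Negz n.+1 + 1 = Negz n by lia.
rewrite /height [X in _ = - X + _]big_nat_recl // addr0 opprD addrAC addNr add0r.
by congr (- _).
Qed.

Lemma heightB1 x (n : int) : height x (n - 1) = height x n - x (n - 1).
Proof. by rewrite -[in height x n](subrK 1 n) heightS addrK. Qed.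

Lemma ysumE x (j k : int) : j <= k -> ysum x j k = height x k - height x j.
Proof.
move=> jk; have -> : k = j + `|k - j|%N%:Z by lia.
elim: `|k - j|%N => [|n IH].
  by rewrite addr0 subrr /ysum subrr big_nil.
have -> : j + n.+1%:Z = j + n%:Z + 1 by lia.
rewrite heightS [RHS]addrAC -IH /ysum.
have -> : absz (j + n%:Z + 1 - j)%R = n.+1 by lia.
have -> : absz (j + n%:Z - j)%R = n by lia.
by rewrite big_nat_recr.
Qed.

Lemma recprE x (i j : int) : recpr x i j <->
  [/\ i < j, height x i <= height x j &
      forall n : int, i < n -> n < j -> height x n < height x i].
Proof.
split=> -[ij yij H]; split=> //.
- by move: yij; rewrite (ysumE _ (ltW ij)) subr_ge0.
- move=> n lin lnj; have := H _ lin lnj.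
  by rewrite (ysumE _ (ltW lin)) subr_lt0.
- by rewrite (ysumE _ (ltW ij)) subr_ge0.
- move=> n lin lnj; have := H _ lin lnj.
  by rewrite (ysumE _ (ltW lin)) subr_lt0.
Qed.

Lemma recpr_fun x (i j k : int) : recpr x i j -> recpr x i k -> j = k.
Proof.
move=> /recprE[ij hij Hj] /recprE[ik hik Hk].
case: (ltgtP j k) => // [jk|kj].
- by have := Hk _ ij jk; lia.
- by have := Hj _ ik kj; lia.
Qed.

Lemma recpr_lt x (i j : int) : recpr x i j -> i < j.
Proof. by case. Qed.

(* [w] is the sequence x(v-1), x(v-2), ... *)
Fixpoint reads (x : int -> int) (v : int) (w : seq int) : Prop :=
  if w is k :: w' then x (v - 1) = k /\ reads x (v - 1) w' else True.

Lemma reads_cat x (v : int) w1 w2 :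
  reads x v (w1 ++ w2) <-> reads x v w1 /\ reads x (v - (size w1)%:Z) w2.
Proof.
elim: w1 v => [|k w1 IH] v /=; first by rewrite subr0; tauto.
have -> : v - (size w1).+1%:Z = v - 1 - (size w1)%:Z by lia.
by rewrite IH; tauto.
Qed.

(* The backward Lukasiewicz word: (offspring number) - 1 of the vertices in
   the order of [offset]. *)
Fixpoint lukt (t : ptree) : seq int :=
  let: Node ts := t in
  ((size ts)%:Z - 1) :: flatten (rev (map lukt ts)).

Definition lukf (ts : seq ptree) : seq int := flatten (rev (map lukt ts)).

Lemma luktE ts : lukt (Node ts) = ((size ts)%:Z - 1) :: lukf ts.
Proof. by []. Qed.

Lemma lukf_cons u ts : lukf (u :: ts) = lukf ts ++ lukt u.
Proof. by rewrite /lukf /= rev_cons flatten_rcons. Qed.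

Lemma ptree_forest_ind (S : ptree -> Prop) (S' : seq ptree -> Prop) :
  S' [::] -> (forall u ts, S u -> S' ts -> S' (u :: ts)) ->
  (forall ts, S' ts -> S (Node ts)) -> (forall t, S t) /\ (forall ts, S' ts).
Proof.
move=> S0 SC SN.
have H : forall t, S t.
  elim/ptree_nested_ind => ts IH; apply: SN.
  elim: ts IH => // u ts IHts IH; apply: SC; first by apply: IH; left.
  by apply: IHts => v vts; apply: IH; right.
by split=> //; elim=> // u ts IH; exact: SC.
Qed.

Lemma size_luk :
  (forall t, size (lukt t) = nverts t) /\ (forall ts, size (lukf ts) = fverts ts).
Proof.
apply: ptree_forest_ind => // [u ts Hu Hts|ts Hts].
  by rewrite lukf_cons size_cat Hu Hts fverts_cons addnC.
by rewrite luktE /= Hts.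
Qed.

Definition size_lukf := size_luk.2.

(** First-passage property of Lukasiewicz words: read backwards, the word of a tree lifts the height
    by one level, reached for the first time at its end. A forest climbs one level per tree; the
    letter of a root first changes the height by [1 - size ts], and its [size ts] subtrees make up
    for it. *)
Lemma reads_height x :
  (forall t (v : int), reads x v (lukt t) ->
     height x (v - (nverts t)%:Z) = height x v + 1 /\
     forall l : int, v - (nverts t)%:Z < l -> l <= v -> height x l <= height x v) /\
  (forall ts (v : int), reads x v (lukf ts) ->
     height x (v - (fverts ts)%:Z) = height x v + (size ts)%:Z /\
     forall l : int, v - (fverts ts)%:Z < l -> l <= v ->
       height x l < height x v + (size ts)%:Z).
Proof.
apply: ptree_forest_ind => [v _|u ts Hu Hts v|ts Hts v].
- split=> [|l]; first by rewrite subr0 addr0.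
  by rewrite subr0 => h1 h2; exfalso; lia.
- rewrite lukf_cons => /reads_cat[/Hts[hE hlt]].
  rewrite size_lukf => /Hu[hE' hle]; rewrite fverts_cons /=; split.
    have -> : v - (nverts u + fverts ts)%N%:Z =
      v - (fverts ts)%:Z - (nverts u)%:Z by lia.
    rewrite hE' hE. lia.
  move=> l lo hi; have [l1|l1] := ltP (v - (fverts ts)%:Z) l.
    by have := hlt _ l1 hi; lia.
  have : height x l <= height x (v - (fverts ts)%:Z) by apply: hle; lia.
  by rewrite hE; lia.
- rewrite luktE /= => -[xE /Hts[hE hlt]].
  have h1 := heightB1 x v; rewrite xE in h1.
  have -> : v - (nverts (Node ts))%:Z = v - 1 - (fverts ts)%:Z.
    by rewrite /= -/(fverts ts); lia.
  split; first by rewrite hE h1; lia.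
  move=> l lo hi; have [->//|lv] := eqVneq l v.
  by have := hlt l lo; lia.
Qed.

Definition reads_forest_height x := (reads_height x).2.

Lemma reads_nth x (v : int) ts k : reads x v (lukf ts) -> (k < size ts)%N ->
  reads x (v - (fverts (drop k.+1 ts))%:Z) (lukt (nth leaf ts k)) /\
  reads x v (lukf (drop k.+1 ts)).
Proof.
elim: ts k => //= u ts IH k; rewrite lukf_cons => /reads_cat[Rts].
rewrite size_lukf => Ru; case: k => [|k] kts /=; first by rewrite drop0.
exact: IH.
Qed.

(* A vertex at [v] with children [ts], possibly besides a further child with
   smaller label; spine vertices are of the latter kind. *)
Definition grown (x : int -> int) (v : int) (ts : seq ptree) : Prop :=
  (size ts)%:Z <= x (v - 1) + 1 /\ reads x (v - 1) (lukf ts).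

Lemma grown_tree x (v : int) ts : reads x v (lukt (Node ts)) -> grown x v ts.
Proof. by rewrite luktE /= => -[xE R]; split=> //; lia. Qed.

(** If the increment leaves room for one more child, the first position below the words of the
    listed children has record parent [v]. This yields the spine edges. *)
Lemma grown_last x (v : int) ts : grown x v ts ->
  (size ts)%:Z <= x (v - 1) ->
  height x (v - (nverts (Node ts))%:Z) <= height x v /\
  (forall l : int, v - (nverts (Node ts))%:Z < l -> l < v ->
     height x l < height x (v - (nverts (Node ts))%:Z)).
Proof.
move=> [_ /reads_forest_height[hE hlt]] le.
have -> : v - (nverts (Node ts))%:Z = v - 1 - (fverts ts)%:Z.
  by rewrite /= -/(fverts ts); lia.
have h1 := heightB1 x v.
by split=> [|l lo hi]; [lia | have := hlt l lo; lia].
Qed.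

(** The later siblings of child [k] have lifted the height from [v - 1] by one level each, which
    stays within the increment [x (v - 1)]; by first passage no earlier position is as high. *)
Lemma grown_child_recpr x (v : int) ts k : grown x v ts -> (k < size ts)%N ->
  recpr x (v - 1 - (fverts (drop k.+1 ts))%:Z) v.
Proof.
move=> [lex R] kts; have [_ Rd] := reads_nth R kts.
have [hE hlt] := reads_forest_height Rd.
have h1 := heightB1 x v; have sd := size_drop k.+1 ts.
by apply/recprE; split=> [||n lo hi]; [lia | lia | have := hlt n lo; lia].
Qed.

Lemma grown_recpr x (v : int) ts b k : grown x v ts -> valid (Node ts) (rcons b k) ->
  recpr x (v - (offset (Node ts) (rcons b k))%:Z) (v - (offset (Node ts) b)%:Z).
Proof.
elim: b v ts => [|l b IH] v ts G /=.
  rewrite andbT => kts; have := grown_child_recpr G kts.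
  by congr (recpr x _ _); lia.
move=> /andP[lts]; have [Rl _] := reads_nth G.2 lts.
case: (nth leaf ts l) Rl => us /grown_tree Gl /(IH _ _ Gl).
by congr (recpr x _ _); lia.
Qed.

Lemma reads_forest_inj x (v : int) ts ts' : size ts = size ts' ->
  reads x v (lukf ts) -> reads x v (lukf ts') -> ts = ts'.
Proof.
(* Arbitrary suffixes [w], [w'] are allowed because the two words to be compared are not known
   beforehand to have equal length. *)
suff: (forall t, forall t' (v : int) w w', reads x v (lukt t ++ w) ->
         reads x v (lukt t' ++ w') -> t = t') /\
      (forall ts, forall ts' (v : int) w w', size ts = size ts' ->
         reads x v (lukf ts ++ w) -> reads x v (lukf ts' ++ w') -> ts = ts').
  by move=> [_ H] ss R R'; apply: (H _ _ v [::] [::] ss); rewrite cats0.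
apply: ptree_forest_ind => [ts0 v0 w0 w0'|u us Hu Hus [] // u' us' v0 w0 w0' [ss]|us Hus [us'] v0 w0 w0'].
- by move/esym/size0nil.
- rewrite !lukf_cons -!catA => R R'; have E := Hus _ _ _ _ ss R R'; subst us'.
  move: R R' => /reads_cat[_ R] /reads_cat[_ R'].
  by rewrite (Hu _ _ _ _ R R').
- rewrite !luktE /= => -[xE R] [xE' R'].
  by congr Node; apply: (Hus _ _ _ _ _ R R'); lia.
Qed.

(** * Spine points and bushes *)

Definition spine (x : int -> int) (p : int) : Prop :=
  forall l : int, l < p -> height x l <= height x p.

Definition rootat (x : int -> int) (p : int) (t : ptree) : Prop :=
  (size (children t))%:Z <= x (p - 1) /\ reads x (p - 1) (lukf (children t)).

(* [us] lists the bushes of consecutive spine points, from the top one [p]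
   downwards; the last one is followed by another spine point. *)
Fixpoint chain (x : int -> int) (p : int) (us : seq ptree) : Prop :=
  if us is u :: us' then rootat x p u /\ chain x (p - (nverts u)%:Z) us'
  else spine x p.

Lemma rootat_grown x (p : int) t : rootat x p t -> grown x p (children t).
Proof. by move=> [le R]; split=> //; lia. Qed.

Lemma rootat_height x (p : int) t : rootat x p t ->
  height x (p - (nverts t)%:Z) <= height x p /\
  (forall l : int, p - (nverts t)%:Z < l -> l < p ->
     height x l < height x (p - (nverts t)%:Z)).
Proof.
by case: t => ts Rt; apply: grown_last; [exact: (rootat_grown Rt) | case: Rt].
Qed.

Lemma rootat_spine x (p : int) t :
  rootat x p t -> spine x (p - (nverts t)%:Z) -> spine x p.
Proof.
move=> /rootat_height[le lt] sp l lp.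
case: (ltgtP l (p - (nverts t)%:Z)) => [/sp|/lt/(_ lp)|->//]; lia.
Qed.

Lemma chain_spine x (p : int) us : chain x p us -> spine x p.
Proof.
by elim: us p => [|u us IH] p //= [Ru /IH]; exact: rootat_spine.
Qed.

Lemma rootat_notspine x (p l : int) t :
  rootat x p t -> p - (nverts t)%:Z < l -> l < p -> ~ spine x l.
Proof.
by move=> /rootat_height[_ lt] lo hi /(_ _ lo); have := lt _ lo hi; lia.
Qed.

(** A bush has no spine point in its interior, so both bushes end at the first spine point below [p]
    and have equal size. The height gained then gives the same number of children, and the word
    determines the forest. *)
Lemma rootat_inj x (p : int) t t' : rootat x p t -> rootat x p t' ->
  spine x (p - (nverts t)%:Z) -> spine x (p - (nverts t')%:Z) -> t = t'.
Proof.
move=> Rt Rt' st st'.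
have g := nverts_gt0 t; have g' := nverts_gt0 t'.
case: (ltngtP (nverts t) (nverts t')) => N.
- by case: (rootat_notspine Rt' _ _ st); lia.
- by case: (rootat_notspine Rt _ _ st'); lia.
case: t t' N Rt Rt' {st st' g g'} => ts [ts'] [] N [_ /= R] [_ /= R']; congr Node.
apply: (reads_forest_inj _ R R').
have [h _] := reads_forest_height R; have [h' _] := reads_forest_height R'.
by move: h h'; rewrite /fverts N /=; lia.
Qed.

(** Were the bushes to overlap with different tops, the lower top would be a spine point inside the
    other bush. *)
Lemma bush_disjoint x (p p' l : int) t t' :
  rootat x p t -> rootat x p' t' -> spine x p -> spine x p' ->
  p - (nverts t)%:Z < l <= p -> p' - (nverts t')%:Z < l <= p' -> p = p'.
Proof.
move=> Rt Rt' sp sp' l1 l2; case: (ltgtP p p') => // pp.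
- by case: (rootat_notspine Rt' _ _ sp); lia.
- by case: (rootat_notspine Rt _ _ sp'); lia.
Qed.

Lemma chain_take x (p : int) us j : (j <= size us)%N -> chain x p us ->
  spine x (p - (fverts (take j us))%:Z).
Proof.
elim: us p j => [|u us IH] p [|j] //= jus.
- by rewrite subr0.
- by move/(@chain_spine x p (u :: us)); rewrite subr0.
move=> [_ /(IH _ _ jus)]; congr (spine x _).
by rewrite fverts_cons; lia.
Qed.

Lemma chain_nth x (p : int) us j : (j < size us)%N -> chain x p us ->
  rootat x (p - (fverts (take j us))%:Z) (nth leaf us j).
Proof.
elim: us p j => [|u us IH] p [|j] //= jus; first by rewrite subr0 => -[].
move=> [_ /(IH _ _ jus)]; congr (rootat x _ _).
by rewrite fverts_cons; lia.
Qed.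

(** The position [l] determines the top of its bush by disjointness. Going up, the site just above a
    spine point lies in the next bush, whose top is therefore determined as well. *)
Lemma chain_top_inj x (p p' l : int) us us' m :
  (m < size us)%N -> (m < size us')%N -> chain x p us -> chain x p' us' ->
  0 <= p - (fverts (take m us))%:Z - l < (nverts (nth leaf us m))%:Z ->
  0 <= p' - (fverts (take m us'))%:Z - l < (nverts (nth leaf us' m))%:Z ->
  p = p'.
Proof.
elim: m us us' p p' => [|m IH] [|u us] [|u' us'] p p' //= mus mus' Cu Cu' h h'.
all: have sp := @chain_spine x p (u :: us) Cu.
all: have sp' := @chain_spine x p' (u' :: us') Cu'.
all: move: Cu Cu' => [Ru Cu] [Ru' Cu'].
  by apply: (@bush_disjoint x p p' l _ _ Ru Ru') => //; move: h h'; rewrite /fverts /=; lia.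
have E : p - (nverts u)%:Z = p' - (nverts u')%:Z.
  by apply: (IH us us') => //; move: h h'; rewrite !fverts_cons; lia.
apply: (@bush_disjoint x p p' (p - (nverts u)%:Z + 1) _ _ Ru Ru') => //.
- by have := nverts_gt0 u; lia.
- by have := nverts_gt0 u'; lia.
Qed.

Lemma chain_inj x (p : int) us us' : size us = size us' ->
  chain x p us -> chain x p us' -> us = us'.
Proof.
elim: us us' p => [|u us IH] [] // u' us' p [] ss /= [Ru Cu] [Ru' Cu'].
have E := rootat_inj Ru Ru' (chain_spine Cu) (chain_spine Cu'); subst u'.
by rewrite (IH us' _ ss Cu Cu').
Qed.

(* The label [0] is the vertex of address [a] in the [m]-th bush of [us]. *)
Definition located (x : int -> int) (m : nat) (us : seq ptree) (a : seq nat) : Prop :=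
  [/\ (m < size us)%N, valid (nth leaf us m) a &
     chain x (fverts (take m us) + offset (nth leaf us m) a)%N%:Z us].

(** Makes the located events disjoint: the position 0 fixes the top of the chain, then the bushes,
    then the address through its offset. *)
Lemma located_inj x m us us' a a' : size us = size us' ->
  located x m us a -> located x m us' a' -> us = us' /\ a = a'.
Proof.
move=> ss [ms va C] [ms' va' C'].
have lt := offset_lt va; have lt' := offset_lt va'.
have E : (fverts (take m us) + offset (nth leaf us m) a)%N%:Z =
         (fverts (take m us') + offset (nth leaf us' m) a')%N%:Z.
  by apply: (@chain_top_inj x _ _ 0 us us' m) => //; lia.
rewrite -E in C'; have E' := chain_inj ss C C'; subst us'.
by split=> //; apply: (offset_inj va va'); lia.
Qed.

(** * Local isomorphism with the Eternal Kesten Tree *)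

Section LocalIso.
Context (V W : Type) (pr lt : V -> V -> Prop) (pr' lt' : W -> W -> Prop).
(** [D n u] is to be read as: [u] is at least [n] steps away from the boundary of the region where
    [phi] is controlled. *)
Context (D : nat -> W -> Prop) (phi : W -> V).
Hypothesis Dle : forall n u, D n.+1 u -> D n u.
Hypothesis Dadj : forall n u w, D n.+1 u -> adj pr' u w -> D n w.
Hypothesis phi_adj : forall u w, D 1 u -> adj pr' u w -> adj pr (phi u) (phi w).
Hypothesis adj_phi : forall u j, D 1 u -> adj pr (phi u) j ->
  exists w, adj pr' u w /\ phi w = j.
Hypothesis phi_inj : forall u w, D 1 u -> D 1 w -> phi u = phi w -> u = w.
Hypothesis phi_pr : forall u w, D 1 u -> D 1 w ->
  pr (phi u) (phi w) <-> pr' u w.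
Hypothesis phi_lt : forall u w, D 1 u -> D 1 w ->
  lt (phi u) (phi w) <-> lt' u w.

Lemma local_antimono m n u : (m <= n)%N -> D n u -> D m u.
Proof.
by move=> /subnK <-; elim: (n - m)%N => //= k IH /Dle; rewrite -/addn; exact: IH.
Qed.

Lemma local_within r u w : D r.+1 u -> Defs.within pr' r u w ->
  D 1 w /\ Defs.within pr r (phi u) (phi w).
Proof.
elim: r u => [|r IH] u Du /=; first by move=> <-.
case=> [<-|[z [uz zw]]].
  by split; [exact: (local_antimono _ Du) | left].
have [Dw wi] := IH _ (Dadj Du uz) zw; split=> //; right; exists (phi z).
by split=> //; apply: phi_adj => //; exact: (local_antimono _ Du).
Qed.

Lemma within_local r u j : D r.+1 u -> Defs.within pr r (phi u) j ->
  exists2 w, phi w = j & Defs.within pr' r u w.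
Proof.
elim: r u => [|r IH] u Du /=; first by move=> <-; exists u.
case=> [<-|[z [uz zj]]]; first by exists u => //; left.
have [|w' [uw' wz]] := adj_phi _ uz; first exact: (local_antimono _ Du).
rewrite -wz in zj; have [w wj w'w] := IH _ (Dadj Du uw') zj.
by exists w => //; right; exists w'.
Qed.

Lemma local_ball_iso r u n (F : fshape n) : D r.+1 u ->
  ball_iso pr lt r (phi u) F <-> ball_iso pr' lt' r u F.
Proof.
move=> Du; split=> -[f [finj froot fball fpr flt]].
  (* Preimages of the enumerated vertices are chosen inside the ball around [u], where [phi] is
     injective. *)
  have /(choice (P := fun i w => phi w = f i /\ Defs.within pr' r u w)) [g gP] :
      forall i, exists w, phi w = f i /\ Defs.within pr' r u w.
    move=> i; have /(within_local Du) [w wE ww] : Defs.within pr r (phi u) (f i).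
      by apply/fball; exists i.
    by exists w.
  have gD i : D 1 (g i) by case: (local_within Du (gP i).2).
  exists g; split.
  - by move=> i j E; apply: finj; rewrite -(gP i).1 -(gP j).1 E.
  - by apply: phi_inj => //; [exact: (local_antimono _ Du) | rewrite (gP _).1].
  - move=> w; split=> [uw|[i <-]]; last by case: (gP i).
    have [Dw /fball[i fi]] := local_within Du uw.
    by exists i; apply: phi_inj; rewrite // (gP i).1.
  - by move=> i j; rewrite fpr -(gP i).1 -(gP j).1 phi_pr.
  - by move=> i j; rewrite flt -(gP i).1 -(gP j).1 phi_lt.
have fD i : Defs.within pr' r u (f i) by apply/fball; exists i.
have fD1 i : D 1 (f i) by case: (local_within Du (fD i)).
exists (phi \o f); split=> /=.
- by move=> i j /phi_inj; move=> /(_ (fD1 i) (fD1 j)) /finj.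
- by rewrite froot.
- move=> j; split=> [/(within_local Du)[w <- /fball[i <-]]|[i <-]].
    by exists i.
  by case: (local_within Du (fD i)).
- by move=> i j; rewrite fpr phi_pr.
- by move=> i j; rewrite flt phi_lt.
Qed.
End LocalIso.

(** * A window of bushes inside the record graph *)

Section WindowIso.
(** [rp i] is the position of the spine point that plays the role of the root of the tree with index
    [i]. *)
Context (x : int -> int) (s : int) (tr : int -> ptree) (rp : int -> int).
Hypothesis s_ge0 : 0 <= s.
Hypothesis rpB1 : forall i : int, - s <= i -> i <= s ->
  rp (i - 1) = rp i - (nverts (tr i))%:Z.
Hypothesis rp_root : forall i : int, - s <= i -> i <= s -> rootat x (rp i) (tr i).
Hypothesis rp_spine : forall i : int, - s <= i + 1 -> i <= s -> spine x (rp i).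

(** An edge changes the bush index by at most one, so the slack [n] allows [n] steps without leaving
    the window. *)
Definition in_window (n : nat) (u : int * seq nat) : Prop :=
  `|u.1| + n%:Z <= s /\ valid (tr u.1) u.2.

Definition label (u : int * seq nat) : int := rp u.1 - (offset (tr u.1) u.2)%:Z.

Lemma label_bounds u : in_window 0 u -> rp (u.1 - 1) < label u <= rp u.1.
Proof.
move=> [us va]; have := offset_lt va; rewrite /label rpB1; lia.
Qed.

Lemma rp_lt (i j : int) : - s <= i + 1 -> i < j -> j <= s -> rp i < rp j.
Proof.
have step (k : int) : - s <= k + 1 -> k + 1 <= s -> rp k < rp (k + 1).
  move=> sk ks; have := rpB1 sk ks; rewrite addrK => ->.
  by have := nverts_gt0 (tr (k + 1)); lia.
move=> si ij js; have -> : j = i + 1 + (absz (j - i)%R).-1%:Z by lia.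
have : i + 1 + (absz (j - i)%R).-1%:Z <= s by lia.
elim: (absz _).-1 => [|n IH] ns; first by rewrite addr0; apply: step; lia.
have -> : i + 1 + n.+1%:Z = i + 1 + n%:Z + 1 by lia.
by apply: lt_trans (IH _) (step _ _ _); lia.
Qed.

Lemma label_inj u w : in_window 0 u -> in_window 0 w -> label u = label w -> u = w.
Proof.
case: u => i a; case: w => j b Du Dw E.
have ij : i = j.
  have mono (k l : int) : - s <= k -> k < l -> l <= s -> rp k <= rp (l - 1).
    move=> sk kl ls; case: (ltgtP k (l - 1)) => [kl1|kl1|-> //]; last by lia.
    by apply: ltW; apply: rp_lt; lia.
  have := label_bounds Du; have := label_bounds Dw; rewrite -E /=.
  case: Du => /= ius _; case: Dw => /= jus _.
  case: (ltgtP i j) => // ij.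
  - by have : rp i <= rp (j - 1) by [apply: mono; lia]; lia.
  - by have : rp j <= rp (i - 1) by [apply: mono; lia]; lia.
rewrite -ij in E Dw *; congr pair; case: Du Dw => /= _ va [_ vb].
by apply: (offset_inj va vb); move: E; rewrite /label /=; lia.
Qed.

Lemma label_surj (j : int) : rp (- s - 1) < j -> j <= rp s ->
  exists2 u, in_window 0 u & label u = j.
Proof.
move=> lo hi.
have [i [si is_] ji] : exists2 i : int, - s <= i /\ i <= s & rp (i - 1) < j <= rp i.
  suff: forall n : nat, - s - 1 + n%:Z <= s -> j <= rp (- s - 1 + n%:Z) ->
      exists2 i : int, - s <= i /\ i <= s & rp (i - 1) < j <= rp i.
    have E : - s - 1 + (absz (s + s + 1)%R)%:Z = s by lia.
    by move/(_ (absz (s + s + 1)%R)); rewrite E; exact.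
  elim=> [|n IH] ns jle; first by rewrite addr0 in jle; lia.
  have E : - s - 1 + n.+1%:Z - 1 = - s - 1 + n%:Z by lia.
  have [jn|jn] := leP j (rp (- s - 1 + n%:Z)); first by apply: IH => //; lia.
  by exists (- s - 1 + n.+1%:Z); [lia | rewrite E jn].
have [a va am] : exists2 a, valid (tr i) a & offset (tr i) a = absz (rp i - j)%R.
  by apply: offset_surj; move: ji; rewrite rpB1 //; lia.
exists (i, a); first by split=> //=; lia.
by rewrite /label /= am; lia.
Qed.

Lemma ektpr_exists u : valid (tr u.1) u.2 -> exists w, ektpr tr u w.
Proof.
case: u => i a /= va; case: (lastP a) va => [|b k] va.
  by exists (i + 1, [::]); split=> //; right.
by exists (i, b); split=> //; left; exists b, k.
Qed.

(** The side condition excludes the root of the top bush, whose parent lies outside the window. *)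
Lemma label_recpr u w : in_window 0 u -> u.1 < s \/ u.2 <> [::] -> ektpr tr u w ->
  in_window 0 w /\ recpr x (label u) (label w).
Proof.
case: u => i a [/= us va] nt [_ []] /=; last first.
  case=> a0 ->; subst a; have {nt} is_ : i < s by case: nt.
  split; first by split=> //=; lia.
  rewrite /label /= !subr0; have := @rpB1 (i + 1); rewrite addrK => rpE.
  have Rt : rootat x (rp (i + 1)) (tr (i + 1)) by apply: rp_root; lia.
  have [le lt] := rootat_height Rt; rewrite -rpE in le lt; try lia.
  apply/recprE; split=> //; first by apply: rp_lt; lia.
case=> b [k [ab ->]]; subst a; have [vb _] := offset_rcons va.
split; first by split.
have Rt : rootat x (rp i) (tr i) by apply: rp_root; lia.
have := rootat_grown Rt; rewrite /label /=.
by case: (tr i) va => ts va /= G; exact: grown_recpr.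
Qed.

Lemma recpr_label u (j : int) : in_window 1 u -> recpr x (label u) j ->
  exists2 w, ektpr tr u w & label w = j.
Proof.
move=> [us va] uj; have [w uw] := ektpr_exists va.
exists w => //; have [||_ uw'] := label_recpr _ _ uw.
- by split=> //; lia.
- by left; lia.
- exact: recpr_fun uw' uj.
Qed.

Lemma recpr_label_child w (j : int) : in_window 1 w -> recpr x j (label w) ->
  exists2 u, in_window 0 u & ektpr tr u w /\ label u = j.
Proof.
move=> Dw jw; have jlt := recpr_lt jw.
have Dw0 : in_window 0 w by case: Dw => ws va; split=> //; lia.
have Bw := label_bounds Dw0; have [ws vw] := Dw.
have rws : rp w.1 <= rp s.
  case: (ltgtP w.1 s) => [ws'|ws'|-> //]; last by lia.
  by apply: ltW; apply: rp_lt; lia.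
have rsw : rp (- s) <= rp (w.1 - 1).
  case: (ltgtP (- s) (w.1 - 1)) => [ws'|ws'|<- //]; last by lia.
  by apply: ltW; apply: rp_lt; lia.
have rlt : rp (- s - 1) < rp (- s) by apply: rp_lt; lia.
(* A [j] at or below the lowest spine point would meet the spine point [rp (- s)], which is at least
   as high, strictly before [label w]; its record parent could not be [label w]. *)
have jgt : rp (- s - 1) < j.
  have sp : spine x (rp (- s - 1)) by apply: rp_spine; lia.
  have sp' : spine x (rp (- s)) by apply: rp_spine; lia.
  rewrite ltNge; apply/negP => jle.
  move/recprE: jw => [_ _ /(_ (rp (- s)))].
  have : height x j <= height x (rp (- s)) by apply: sp'; lia.
  by lia.
have [|u Du uE] := label_surj jgt; first lia.
exists u => //; split=> //; rewrite -uE in jw jlt.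
have [w' uw'] := ektpr_exists Du.2.
(* The root of the top bush has label [rp s], which is not below [label w]. *)
have nt : u.1 < s \/ u.2 <> [::].
  case: u Du uE jw jlt uw' => i [|k a] Du uE jw jlt uw'; last by right.
  left; move: jlt Du => /=; rewrite /label /= subr0 => jlt [/= ius _].
  rewrite ltNge; apply/negP => si; have E : i = s by lia.
  by rewrite E in jlt; move: Bw; rewrite /label; lia.
have [Dw' jw'] := label_recpr Du nt uw'.
by rewrite -(label_inj Dw' Dw0 (recpr_fun jw' jw)).
Qed.

Lemma label_ektpr u w : in_window 1 u -> in_window 0 w ->
  recpr x (label u) (label w) <-> ektpr tr u w.
Proof.
move=> Du Dw; have Du0 : in_window 0 u by case: Du => us va; split=> //; lia.
have nt : u.1 < s \/ u.2 <> [::] by left; case: Du; lia.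
split=> [uw|/(label_recpr Du0 nt)[]//].
have [w' uw'] := ektpr_exists Du.2; have [Dw' uw''] := label_recpr Du0 nt uw'.
by rewrite -(label_inj Dw' Dw (recpr_fun uw'' uw)).
Qed.

Lemma ektpr_window n u w : in_window n.+1 u -> adj (ektpr tr) u w -> in_window n w.
Proof.
case: u => i a; case: w => j b [/= us va]; rewrite /adj /ektpr /=.
case=> -[v' [[b' [k [E [E1 E2]]]]|[E [E1 E2]]]]; split=> /=; try lia.
- by move: v'; rewrite E E1 E2 => /offset_rcons[].
- by rewrite E2.
Qed.

Lemma ektkey_rcons i a k : ektkey (i, rcons a k) = k.+1.
Proof. by case: a => //= h a; rewrite /ektkey /= last_rcons. Qed.

Lemma ektkey_inj u w p : ektpr tr u p -> ektpr tr w p -> ektkey u = ektkey w -> u = w.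
Proof.
case: u => i a; case: w => j b; case: p => q c; rewrite /ektpr /=.
move=> [_ [[a' [k [-> [-> ->]]]]|[-> [E1 E2]]]] [_ [[b' [l [-> [E3 E4]]]]|[-> [E3 E4]]]].
- by rewrite !ektkey_rcons E3 E4 => -[->].
- by rewrite ektkey_rcons.
- by rewrite ektkey_rcons.
- by move=> _; congr pair; lia.
Qed.

(** Exploring the last child first makes labels increase along the plane order. The spine child, of
    key 0, lies below the whole bush of its parent, in agreement with its being the smallest
    child. *)
Lemma ektkey_label u w p : in_window 0 u -> in_window 0 w ->
  ektpr tr u p -> ektpr tr w p -> (ektkey u < ektkey w)%N -> label u < label w.
Proof.
move=> Du Dw [_ up] [_ wp].
case: wp Dw => [[b [l]]|]; case: w => j b0 /= -[-> E] Dw //; subst p.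
rewrite ektkey_rcons.
case: up Du => [[a [k]]|]; case: u => i a0 /= -[-> [E1 E2]] Du.
  subst; rewrite ektkey_rcons ltnS => kl; case: Dw => /= _ /offset_sibling/(_ kl).
  by rewrite /label /=; lia.
by move=> _; have /andP[+ _] := label_bounds Dw; rewrite /= E1 addrK /label /= subr0.
Qed.

Lemma label_ektlt u w : in_window 1 u -> in_window 1 w ->
  reclt x (label u) (label w) <-> ektlt tr u w.
Proof.
move=> Du Dw.
have D01 v : in_window 1 v -> in_window 0 v by case=> vs vv; split=> //; lia.
split=> -[p [up wp lt]]; last first.
  exists (label p); have Dp := ektpr_window Du (or_introl up).
  split; [exact/label_ektpr|exact/label_ektpr|].
  exact: (ektkey_label (D01 _ Du) (D01 _ Dw) up wp).
have [q uq qE] := recpr_label Du up; subst p.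
have Dq := ektpr_window Du (or_introl uq).
move/(label_ektpr Dw Dq): wp => wq.
exists q; split=> //; case: (ltngtP (ektkey u) (ektkey w)) => // K.
- by have := ektkey_label (D01 _ Dw) (D01 _ Du) wq uq K; lia.
- by rewrite (ektkey_inj uq wq K) ltxx in lt.
Qed.

Lemma window_ball_iso (a : seq nat) r n (F : fshape n) :
  r.+1%:Z <= s -> valid (tr 0) a ->
  ball_iso (recpr x) (reclt x) r (label (0, a)) F <->
  ball_iso (ektpr tr) (ektlt tr) r (0, a) F.
Proof.
move=> rs va.
have D01 v : in_window 1 v -> in_window 0 v by case=> vs vv; split=> //; lia.
apply: (@local_ball_iso _ _ _ _ _ _ in_window label).
- by move=> k u [us vu]; split=> //; lia.
- exact: ektpr_window.
- move=> u w Du uw; have Dw := ektpr_window Du uw.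
  case: uw => [uw|wu]; [left; exact/label_ektpr|right].
  have nt : w.1 < s \/ w.2 <> [::].
    case: w wu Dw => j b; case: u Du => i c [/= us _]; rewrite /ektpr /=.
    by move=> [_ [[b' [k [-> _]]]|[_ [E _]]]] _; [right; case: b' | left; lia].
  by case: (label_recpr Dw nt wu).
- move=> u j Du [uj|ju].
    by have [w uw wj] := recpr_label Du uj; exists w; split=> //; left.
  by have [w _ [wu wj]] := recpr_label_child Du ju; exists w; split=> //; right.
- by move=> u w Du Dw; apply: label_inj; exact: D01.
- by move=> u w Du Dw; apply: label_ektpr => //; exact: D01.
- exact: label_ektlt.
- by split=> //=; lia.
Qed.
End WindowIso.

(* Indexed so that the trees appear from the top of the spine downwards. *)
Definition tree_window (s : nat) (tr : int -> ptree) : seq ptree :=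
  mkseq (fun j => tr (s%:Z - j%:Z)) s.*2.+1.

Lemma located_ball_iso x (tr : int -> ptree) a s r n (F : fshape n) :
  (r < s)%N -> located x s (tree_window s tr) a ->
  ball_iso (recpr x) (reclt x) r 0 F <->
  ball_iso (ektpr tr) (ektlt tr) r (0, a) F.
Proof.
move=> rs []; have sz : size (tree_window s tr) = s.*2.+1 by rewrite size_mkseq.
have nthE j : (j < s.*2.+1)%N -> nth leaf (tree_window s tr) j = tr (s%:Z - j%:Z).
  by move=> js; rewrite nth_mkseq.
rewrite sz nthE; last by lia.
rewrite subrr => _ va C; set p := _%:Z in C.
(* The bushes above index [i] are removed from the top; at [i = - s - 1] all [s.*2.+1] are gone and
   the closing spine point of the chain is reached. *)
pose rp (i : int) : int := p - (fverts (take (absz (s%:Z - i)%R) (tree_window s tr)))%:Z.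
have rp0 : rp 0 - (offset (tr 0) a)%:Z = 0.
  by rewrite /rp /p subr0 absz_nat PoszD [_ + (offset _ _)%:Z]addrC addrK subrr.
rewrite -[X in ball_iso _ _ _ X _ <-> _]rp0 -[_ - _]/(label tr rp (0, a)).
apply: (@window_ball_iso x s%:Z tr rp) => // [i lo hi|i lo hi|i lo hi]; rewrite ?/rp.
- have -> : absz (s%:Z - (i - 1))%R = (absz (s%:Z - i)%R).+1 by lia.
  rewrite (take_nth leaf) ?sz; last by lia.
  rewrite /fverts map_rcons sumn_rcons nthE; last by lia.
  have -> : s%:Z - (absz (s%:Z - i)%R)%:Z = i by lia.
  lia.
- have ji : (absz (s%:Z - i)%R < size (tree_window s tr))%N by rewrite sz; lia.
  have := chain_nth ji C; rewrite nthE -?sz //.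
  by have -> : s%:Z - (absz (s%:Z - i)%R)%:Z = i by lia.
- by apply: chain_take C; rewrite sz; lia.
Qed.

(** * Countable sums and discrete random variables *)

Section CountableSums.
Local Open Scope ereal_scope.

(** Gives sums over words, trees and addresses access to results on series. *)
Lemma esum_pickle (R : realType) (T : countType) (f : T -> \bar R) :
  (forall t, 0 <= f t) ->
  \esum_(t in [set: T]) f t = \sum_(n <oo) oapp f 0 (pickle_inv n).
Proof.
move=> f0; have g0 n : 0 <= oapp f 0 (@pickle_inv T n) by case: pickle_inv.
rewrite nneseries_esumT // (esumID (pickle @` [set: T])) //.
rewrite setTI [X in _ + X]esum1 ?adde0.
  rewrite esum_image; last by move=> t u _ _ /(pcan_inj pickleK).
  by apply: eq_esum => t _; rewrite pickleK_inv.
move=> n [_ nT]; case E: pickle_inv => [t|] //=.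
by case: nT; exists t => //; have := @pickle_invK T n; rewrite E.
Qed.

Lemma esumZl (R : realType) (T : countType) (a : R) (f : T -> \bar R) :
  (0 <= a)%R -> (forall t, 0 <= f t) ->
  \esum_(t in [set: T]) (a%:E * f t) = a%:E * \esum_(t in [set: T]) f t.
Proof.
move=> a0 f0; rewrite !esum_pickle // => [|t]; last by rewrite mule_ge0 ?lee_fin.
rewrite -nneseriesZl // => [|n _]; last by case: pickle_inv.
by apply: eq_eseriesr => n _; case: pickle_inv => //=; rewrite mule0.
Qed.

Lemma measure_countable_bigcup d (T : measurableType d) (R : realType)
    (mu : {measure set T -> \bar R}) (I : countType) (F : I -> set T) :
  (forall i, measurable (F i)) -> trivIset setT F ->
  mu (\bigcup_i F i) = \esum_(i in [set: I]) mu (F i).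
Proof.
move=> mF tF; pose G n := oapp F set0 (@pickle_inv I n).
have -> : \bigcup_i F i = \bigcup_n G n.
  apply/seteqP; split=> [x [i _ Fx]|x [n _]].
    by exists (pickle i) => //; rewrite /G pickleK_inv.
  by rewrite /G; case: pickle_inv => //= i Fx; exists i.
rewrite measure_bigcup.
- rewrite esum_pickle // eseries_mkcond; apply: eq_eseriesr => n _.
  by rewrite in_setT /G; case: pickle_inv => //=; rewrite measure0.
- by move=> n _; rewrite /G; case: pickle_inv => //=.
- move=> m n _ _; rewrite /G.
  have := @pickle_invK I m; have := @pickle_invK I n.
  case: (pickle_inv n) => [j|] /=; last by move=> _ _ [x []].
  case: (pickle_inv m) => [i|] /=; last by move=> _ _ [x []].
  by move=> <- <- /tF ->.
Qed.

Lemma integral_esum d (T : measurableType d) (R : realType)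
    (mu : {measure set T -> \bar R}) (I : countType) (f : I -> T -> \bar R) :
  (forall i, measurable_fun setT (f i)) -> (forall i x, 0 <= f i x) ->
  \int[mu]_x (\esum_(i in [set: I]) f i x) =
  \esum_(i in [set: I]) \int[mu]_x f i x.
Proof.
move=> mf f0; rewrite [RHS]esum_pickle; last by move=> i; exact: integral_ge0.
under eq_integral do rewrite esum_pickle //.
rewrite integral_nneseries //.
- by apply: eq_eseriesr => n _; case: pickle_inv => //=; rewrite integral0.
- by move=> n; case: pickle_inv => [i|] //=; exact: mf.
- by move=> n x _; case: pickle_inv => [i|] //=.
Qed.

Lemma esum_count (R : realType) (T : choiceType) (s : seq T) (p : pred T) :
  uniq s -> \esum_(t in [set: T]) (((t \in s) && p t)%:R : R)%:E =
  ((count p s)%:R : R)%:E.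
Proof.
move=> us; rewrite -size_filter.
transitivity (\esum_(t in [set` [seq x <- s | p x]]) (1 : \bar R)).
  rewrite [RHS]esum_mkcond; apply: eq_esum => t _.
  by rewrite mem_setE mem_filter andbC; case: ifP.
rewrite esum_fset //; first by rewrite -fsbig_seq ?filter_uniq // sumEFin
  big_const_seq count_predT iter_addr_0.
Qed.
End CountableSums.

(** * Measurability of countable combinations of events *)

Section CountableEvents.
Context (d : measure_display) (T : measurableType d).

Lemma measurable_all (I : countType) (F : I -> T -> Prop) :
  (forall i, measurable [set w | F i w]) -> measurable [set w | forall i, F i w].
Proof.
move=> mF; rewrite (_ : [set w | _] = ~` \bigcup_i ~` [set w | F i w]).
  apply: measurableC; apply: countable_bigcupT_measurable => [|i].
    exact: countableP.
  exact: measurableC.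
rewrite setC_bigcup; apply/seteqP; split=> w /= H i.
  by rewrite setCK => _; exact: H.
by have := H i Logic.I; rewrite setCK.
Qed.

Lemma measurable_ex (I : countType) (F : I -> T -> Prop) :
  (forall i, measurable [set w | F i w]) -> measurable [set w | exists i, F i w].
Proof.
move=> mF; rewrite (_ : [set w | _] = \bigcup_i [set w | F i w]).
  by apply: countable_bigcupT_measurable => //; exact: countableP.
by apply/seteqP; split=> w [i]; [exists i|move=> _ Fi; exists i].
Qed.

Lemma measurable_and (F G : T -> Prop) :
  measurable [set w | F w] -> measurable [set w | G w] ->
  measurable [set w | F w /\ G w].
Proof. exact: measurableI. Qed.

Lemma measurable_or (F G : T -> Prop) :
  measurable [set w | F w] -> measurable [set w | G w] ->
  measurable [set w | F w \/ G w].
Proof. exact: measurableU. Qed.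

Lemma measurable_imp (F G : T -> Prop) :
  measurable [set w | F w] -> measurable [set w | G w] ->
  measurable [set w | F w -> G w].
Proof.
move=> mF mG; rewrite (_ : [set w | _] = ~` [set w | F w] `|` [set w | G w]).
  by apply: measurableU => //; exact: measurableC.
apply/seteqP; split=> w /= => [FG|[nF /nF//|//]].
by case: (EM (F w)) => [/FG|]; [right|left].
Qed.

Lemma measurable_const (S : Prop) : measurable [set _ : T | S].
Proof.
case: (EM S) => HS; first by rewrite (_ : [set _ | S] = setT) //; apply/seteqP; split.
by rewrite (_ : [set _ | S] = set0) //; apply/seteqP; split.
Qed.

Lemma measurable_iff (F G : T -> Prop) :
  measurable [set w | F w] -> measurable [set w | G w] ->
  measurable [set w | F w <-> G w].
Proof. by move=> mF mG; apply: measurable_and; exact: measurable_imp. Qed.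

(* A map to a countable type, measurable for the discrete sigma-algebra. *)
Definition discrete (U : Type) (f : T -> U) : Prop :=
  forall u, measurable [set w | f w = u].

Lemma discrete_pred (U : countType) (f : T -> U) (S : U -> Prop) :
  discrete f -> measurable [set w | S (f w)].
Proof.
move=> df; rewrite (_ : [set w | _] = [set w | exists u, f w = u /\ S u]).
  by apply: measurable_ex => u; apply: measurable_and => //; exact: measurable_const.
by apply/seteqP; split=> w /=; [exists (f w)|move=> [u [->]]].
Qed.

Lemma discrete_map2 (U V : countType) (W : Type) (f : T -> U) (g : T -> V)
    (h : U -> V -> W) :
  discrete f -> discrete g -> discrete (fun w => h (f w) (g w)).
Proof.
move=> df dg u; rewrite (_ : [set w | _] =
    [set w | exists a, f w = a /\ exists b, g w = b /\ h a b = u]).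
  apply: measurable_ex => a; apply: measurable_and => //.
  by apply: measurable_ex => b; apply: measurable_and => //; exact: measurable_const.
apply/seteqP; split=> w /= => [<-|[a [<- [b [<- //]]]]].
by exists (f w); split=> //; exists (g w).
Qed.

Lemma discrete_mkseq (U : countType) (f : nat -> T -> U) n :
  (forall k, discrete (f k)) -> discrete (fun w => mkseq (fun k => f k w) n).
Proof.
move=> df; elim: n => [|n IH] u; first exact: (measurable_const ([::] = u)).
rewrite (_ : [set w | _] = [set w | rcons (mkseq (fun k => f k w) n) (f n w) = u]).
  exact: (discrete_map2 (@rcons U) IH (df n)).
by apply/seteqP; split=> w /=; rewrite -[n.+1]addn1 /mkseq iotaD map_cat cats1.
Qed.
End CountableEvents.

Lemma integral_discrete d (T : measurableType d) (R : realType)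
    (P : probability T R) (U : countType) (f : T -> U) (g : U -> R) :
  discrete f -> (forall u, 0 <= g u) ->
  (\int[P]_w (g (f w))%:E =
   \esum_(u in [set: U]) (g u * fine (P [set w | f w = u]))%:E)%E.
Proof.
move=> df g0; have gI0 u w : (0 <= (g u * \1_[set w | f w = u] w)%:E)%E.
  by rewrite lee_fin mulr_ge0.
transitivity (\int[P]_w \esum_(u in [set: U]) (g u * \1_[set w | f w = u] w)%:E)%E.
  apply: eq_integral => w _; rewrite (esumID [set f w]) // !setTI.
  rewrite esum_set1 // esum1 ?adde0; first by rewrite indicE mem_set // mulr1.
  by move=> u /= uf; rewrite indicE memNset ?mulr0 // => E; apply: uf.
rewrite integral_esum // => [|u].
  apply: eq_esum => u _; under eq_integral do rewrite EFinM.
  rewrite ge0_integralZl_EFin //; last exact/measurable_EFinP/measurable_indic.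
  by rewrite integral_indic // setIT EFinM fineK ?fin_num_measure.
apply/measurable_EFinP; apply: measurable_funM => //; exact: measurable_indic.
Qed.

(** * Probability of a word followed by a spine point *)

Definition seg (x : int -> int) (i : nat -> int) (n : nat) : seq int :=
  mkseq (fun k => x (i k)) n.

Definition back (v : int) (k : nat) : int := v - 1 - k%:Z.

Lemma back_inj v : injective (back v).
Proof. by move=> k l; rewrite /back; lia. Qed.

Lemma seg_add x i m n : seg x i (m + n) = seg x i m ++ seg x (i \o addn m) n.
Proof.
rewrite /seg /mkseq iotaD map_cat; congr cat.
by rewrite add0n -[X in iota X]addn0 iotaDl -map_comp.
Qed.

Lemma back_add v m : back v \o addn m = back (v - m%:Z).
Proof. by apply/funext => k; rewrite /back /=; lia. Qed.

Lemma reads_seg x (v : int) w : reads x v w <-> seg x (back v) (size w) = w.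
Proof.
elim: w v => [|k w IH] v //=; rewrite -[(size w).+1]add1n seg_add back_add.
rewrite {1}/seg /= /back subr0 IH; split=> [[-> ->] //|[-> E]]; split=> //.
Qed.

Lemma big_seg x i n : \sum_(k <- seg x i n) k = \sum_(k < n) x (i k).
Proof. by rewrite /seg /mkseq big_map -[X in iota 0 X]subn0 big_mkord. Qed.

(** The spine event truncated to a finite word, as a boolean predicate over which word weights can
    be summed. *)
Definition nonneg_sums (u : seq int) : bool :=
  all (fun m => 0 <= \sum_(k <- take m u) k) (iota 0 (size u).+1).

Lemma nonneg_sums_seg x i n :
  nonneg_sums (seg x i n) <-> forall m, (m <= n)%N -> 0 <= \sum_(k < m) x (i k).
Proof.
have E m : (m <= n)%N -> \sum_(k <- take m (seg x i n)) k = \sum_(k < m) x (i k).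
  move=> mn; rewrite -(subnKC mn) seg_add take_size_cat ?size_mkseq //.
  exact: big_seg.
rewrite /nonneg_sums size_mkseq; split=> [/allP H m mn|H].
  by rewrite -E //; apply: H; rewrite mem_iota.
by apply/allP => m; rewrite mem_iota /= add0n ltnS => mn; rewrite E //; exact: H.
Qed.

Lemma sum_back x (v : int) m :
  \sum_(k < m) x (back v k) = height x v - height x (v - m%:Z).
Proof.
elim: m => [|m IH]; first by rewrite big_ord0 subr0 subrr.
rewrite big_ord_recr /= IH /back.
have -> : v - 1 - m%:Z = v - m%:Z - 1 by lia.
have -> : v - m.+1%:Z = v - m%:Z - 1 by lia.
by have := heightB1 x (v - m%:Z); lia.
Qed.

Lemma spine_seg x (v : int) :
  spine x v <-> forall n, nonneg_sums (seg x (back v) n).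
Proof.
split=> [sp n|H l lv].
  apply/nonneg_sums_seg => m _; rewrite sum_back subr_ge0.
  by case: m => [|m]; [rewrite subr0 | apply: sp; lia].
have /nonneg_sums_seg/(_ _ (leqnn _)) := H (absz (v - l)%R).
rewrite sum_back; have -> : v - (absz (v - l)%R)%:Z = l by lia.
by rewrite subr_ge0.
Qed.

Section Walk.
Context (R : realType) (d : measure_display) (Omega : measurableType d)
  (P : probability Omega R) (X : int -> Omega -> int).
Hypothesis HXmeas : forall n k : int, measurable [set w | X n w = k].
Hypothesis HXiid : forall (s : seq int) (v : int -> int), uniq s ->
  P [set w | forall i, i \in s -> X i w = v i] =
  (\prod_(i <- s) fine (P [set w | X 0 w = v i]))%:E.

Definition step (k : int) : R := fine (P [set w | X 0 w = k]).

Definition weight (w : seq int) : R := \prod_(k <- w) step k.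

Lemma step_ge0 k : 0 <= step k. Proof. exact: fine_ge0. Qed.

Lemma weight_ge0 w : 0 <= weight w.
Proof. by apply: prodr_ge0 => k _; exact: step_ge0. Qed.

Lemma weight_cat u w : weight (u ++ w) = weight u * weight w.
Proof. exact: big_cat. Qed.

Lemma discrete_X n : discrete (X n).
Proof. by move=> k; exact: HXmeas. Qed.

Lemma discrete_seg i n : discrete (fun o => seg (X ^~ o) i n).
Proof. by apply: discrete_mkseq => k; exact: discrete_X. Qed.

Lemma measurable_nonneg_sums i n :
  measurable [set o | nonneg_sums (seg (X ^~ o) i n)].
Proof.
exact: (discrete_pred (fun u => is_true (nonneg_sums u)) (discrete_seg i n)).
Qed.

Lemma P_seg (i : nat -> int) w : injective i ->
  P [set o | seg (X ^~ o) i (size w) = w] = (weight w)%:E.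
Proof.
move=> inj; pose s := mkseq i (size w).
have us : uniq s by rewrite map_inj_uniq ?iota_uniq.
pose v j := nth 0 w (index j s).
have vE k : (k < size w)%N -> v (i k) = nth 0 w k.
  move=> kw; rewrite /v -[X in index X _](nth_mkseq 0 i kw).
  by rewrite index_uniq ?size_mkseq.
transitivity (P [set o | forall j, j \in s -> X j o = v j]).
  congr (P _); apply/seteqP; split=> o /=.
    move=> E j /mapP[k]; rewrite mem_iota /= add0n => kw ->.
    by rewrite vE // -[in RHS]E nth_mkseq.
  move=> H; apply: (@eq_from_nth _ 0); rewrite size_mkseq // => k kw.
  by rewrite nth_mkseq // H ?vE //; apply/mapP; exists k; rewrite // mem_iota.
rewrite HXiid // big_map -[X in iota 0 X]subn0 big_mkord; congr (_%:E).
rewrite /weight (big_nth 0) big_mkord; apply: eq_bigr => k _.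
by rewrite vE.
Qed.

(** The probability that [n] i.i.d. increments form a word in [G]. No index sequence appears, which
    is how stationarity enters. *)
Definition seg_mass (n : nat) (G : pred (seq int)) : \bar R :=
  (\esum_(u in [set: seq int]) (if (size u == n) && G u then weight u else 0)%:E)%E.

Lemma P_seg_split (i : nat -> int) w n (G : pred (seq int)) : injective i ->
  P [set o | seg (X ^~ o) i (size w) = w /\ G (seg (X ^~ o) (i \o addn (size w)) n)] =
  ((weight w)%:E * seg_mass n G)%E.
Proof.
move=> inj; rewrite /seg_mass -esumZl ?weight_ge0 //; last first.
  by move=> u; rewrite lee_fin; case: ifP => // _; exact: weight_ge0.
pose F u := [set o | (size u == n) && G u /\
  seg (X ^~ o) i (size (w ++ u)) = w ++ u].
rewrite (_ : [set o | _] = \bigcup_u F u).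
  rewrite measure_countable_bigcup.
  - apply: eq_esum => u _; rewrite -EFinM; case: ifP => [uG|uG].
      rewrite -weight_cat -(P_seg _ inj); congr (P _).
      by apply/seteqP; split=> o /=; rewrite /F /= uG; [case|].
    by rewrite mulr0 /F uG (_ : [set o | _] = set0) ?measure0 //; apply/seteqP; split=> o /= [].
  - move=> u; apply: measurable_and; first exact: measurable_const.
    exact: discrete_seg.
  - move=> u u' _ _ [z [[/andP[/eqP su _] E] [/andP[/eqP su' _] E']]].
    rewrite !size_cat su in E; rewrite !size_cat su' E in E'.
    by move/eqP: E'; rewrite eqseq_cat // eqxx => /eqP.
apply/seteqP; split=> o /=.
  move=> [E Gs]; exists (seg (X ^~ o) (i \o addn (size w)) n) => //.
  by split; rewrite ?size_mkseq ?eqxx // size_cat size_mkseq seg_add E.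
move=> [u _ [/andP[/eqP su Gu]]]; rewrite size_cat seg_add su => /eqP.
by rewrite eqseq_cat ?size_mkseq // => /andP[/eqP E /eqP ->].
Qed.

Lemma P_seg_mass (i : nat -> int) n (G : pred (seq int)) : injective i ->
  P [set o | G (seg (X ^~ o) i n)] = seg_mass n G.
Proof.
move=> inj; have := @P_seg_split i [::] n G inj.
rewrite /weight big_nil mul1e => <-; congr (P _); apply/seteqP.
have -> : i \o addn (size ([::] : seq int)) = i by [].
by split=> o /=; [split|case].
Qed.

Lemma P_nonneg_cvg (S : Omega -> Prop) (i : nat -> int) :
  measurable [set o | S o] ->
  (fun n => P [set o | S o /\ nonneg_sums (seg (X ^~ o) i n)]) @ \oo -->
  P [set o | S o /\ forall n, nonneg_sums (seg (X ^~ o) i n)].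
Proof.
move=> mS; pose F n := [set o | S o /\ nonneg_sums (seg (X ^~ o) i n)].
have mF n : measurable (F n).
  by apply: measurable_and => //; exact: measurable_nonneg_sums.
rewrite (_ : [set o | S o /\ _] = \bigcap_n F n).
  apply: nonincreasing_cvg_mu => //.
    exact: le_lt_trans (probability_le1 _ (mF 0%N)) (ltry _).
    by apply: bigcap_measurableType => n _; exact: mF.
  move=> m n mn; apply/subsetPset => o [So /nonneg_sums_seg H]; split=> //.
  by apply/nonneg_sums_seg => k km; apply: H; exact: leq_trans mn.
apply/seteqP; split=> [z [So H] n _ //|z H]; split; first by case: (H 0%N I).
by move=> n; case: (H n I).
Qed.

Definition pspine : R := fine (P [set o | spine (X ^~ o) 0]).

Lemma measurable_spine v : measurable [set o | spine (X ^~ o) v].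
Proof.
rewrite (_ : [set o | _] = [set o | forall n, nonneg_sums (seg (X ^~ o) (back v) n)]).
  by apply: measurable_all => n; exact: measurable_nonneg_sums.
by apply/seteqP; split=> o /= /spine_seg.
Qed.

Lemma measurable_reads v w : measurable [set o | reads (X ^~ o) v w].
Proof.
rewrite (_ : [set o | _] = [set o | seg (X ^~ o) (back v) (size w) = w]).
  exact: discrete_seg.
by apply/seteqP; split=> o /= /reads_seg.
Qed.

Lemma nonneg_mass_cvg : seg_mass ^~ nonneg_sums @ \oo --> pspine%:E.
Proof.
rewrite /pspine fineK ?fin_num_measure //; last exact: measurable_spine.
have := @P_nonneg_cvg (fun=> True) (back 0) (measurable_const Omega True).
rewrite (_ : [set o | True /\ _] = [set o | spine (X ^~ o) 0]); last first.
  by apply/seteqP; split=> o /=; [case=> _ /spine_seg|move/spine_seg].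
rewrite (_ : (fun n => P _) = seg_mass ^~ nonneg_sums) //.
apply/funext => n; rewrite -(P_seg_mass _ _ (@back_inj 0)).
by congr (P _); apply/seteqP; split=> o /=; [case|].
Qed.

(** The truncated spine events involve only increments below the word, so they are independent of it
    and their probability does not depend on the position; continuity from above passes to the
    limit. *)
Lemma P_reads_spine v w :
  P [set o | reads (X ^~ o) v w /\ spine (X ^~ o) (v - (size w)%:Z)] =
  (weight w * pspine)%:E.
Proof.
have := @P_nonneg_cvg (fun o => reads (X ^~ o) v w) (back (v - (size w)%:Z))
  (measurable_reads v w).
rewrite (_ : [set o | _ /\ forall n, _] =
  [set o | reads (X ^~ o) v w /\ spine (X ^~ o) (v - (size w)%:Z)]); last first.
  by apply/seteqP; split=> o /= [? /spine_seg].
rewrite (_ : (fun n => P _) = (fun n => (weight w)%:E * seg_mass n nonneg_sums)%E).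
  move/cvg_unique; apply => //; rewrite EFinM; apply: cvgeZl => //.
  exact: nonneg_mass_cvg.
apply/funext => n; rewrite -(P_seg_split _ _ _ (@back_inj v)) back_add.
by congr (P _); apply/seteqP; split=> o /= [/reads_seg].
Qed.
End Walk.

(** * Law of consecutive bushes *)

Lemma gw_lawE (R : realType) (beta : nat -> R) ts :
  gw_law beta (Node ts) = beta (size ts) * \prod_(u <- ts) gw_law beta u.
Proof.
rewrite /=; congr (_ * _).
by elim: ts => [|u ts IH]; rewrite ?big_nil // big_cons IH.
Qed.

Section ChainLaw.
Context (R : realType) (d : measure_display) (Omega : measurableType d)
  (P : probability Omega R) (X : int -> Omega -> int).
Hypothesis HXmeas : forall n k : int, measurable [set w | X n w = k].
Hypothesis HXiid : forall (s : seq int) (v : int -> int), uniq s ->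
  P [set w | forall i, i \in s -> X i w = v i] =
  (\prod_(i <- s) fine (P [set w | X 0 w = v i]))%:E.
Hypothesis Hm1 : (0 < P [set w | X 0%R w = (-1)%R])%E.

Notation c := (c_hit P X).
Notation weight := (weight P X).
Notation pspine := (pspine P X).
Notation law := (ekt_root_law (pibar P X) (pitilde P X)).

(** The first step may already be -1. Positivity matters because [pitilde] contains the inverse of
    [c] at 0. *)
Lemma c_hit_gt0 : 0 < c.
Proof.
have mH : measurable [set w | exists n, \sum_(0 <= k < n) X (Posz k) w = -1].
  apply: measurable_ex => n.
  rewrite (_ : [set w | _] = [set w | \sum_(k <- seg (X ^~ w) Posz n) k = -1]).
    exact: (discrete_pred (fun u => \sum_(k <- u) k = -1) (discrete_seg HXmeas _ _)).
  by apply/seteqP; split=> w /=; rewrite /seg big_map /index_iota subn0.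
rewrite /c_hit fine_gt0 // (lt_le_trans Hm1) /=; last first.
  apply: le_measure; rewrite ?inE // => w /= X0; exists 1%N.
  by rewrite big_nat1.
by apply: le_lt_trans (probability_le1 P mH) (ltry _).
Qed.

(** The exponents [k - 1] of [c], summed over the vertices of a finite tree, give -1, which the
    factor [c] in front compensates. *)
Lemma gw_weight :
  (forall t, c * gw_law (pitilde P X) t = weight (lukt t)) /\
  (forall ts, c ^+ size ts * \prod_(u <- ts) gw_law (pitilde P X) u =
     weight (lukf ts)).
Proof.
apply: ptree_forest_ind => [|u ts Hu Hts|ts Hts].
- by rewrite big_nil expr0 mulr1 /weight big_nil.
- rewrite big_cons lukf_cons weight_cat -Hu -Hts /= exprS; ring.
- rewrite gw_lawE luktE /weight big_cons -/(weight _) -Hts /pitilde -/(step P X _).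
  have <- : c * c ^ ((size ts)%:Z - 1) = c ^+ size ts.
    rewrite -{1}[c]expr1z -expfzDr ?gt_eqF ?c_hit_gt0 //.
    by have -> : 1 + ((size ts)%:Z - 1) = (size ts)%:Z by lia.
  ring.
Qed.

Lemma lawE ts :
  law (Node ts) = fine (P [set w | (size ts)%:Z <= X 0 w]) * weight (lukf ts).
Proof. by rewrite /= -gw_weight.2 /pibar mulrA. Qed.

Lemma law_ge0 t : 0 <= law t.
Proof.
case: t => ts; rewrite lawE mulr_ge0 ?weight_ge0 //.
by rewrite fine_ge0 // measure_ge0.
Qed.

Lemma pspine_ge0 : 0 <= pspine.
Proof. by rewrite fine_ge0 // measure_ge0. Qed.

Lemma measurable_rootat v t : measurable [set w | rootat (X ^~ w) v t].
Proof.
apply: measurable_and; last exact: measurable_reads.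
exact: (discrete_pred (fun k => is_true ((size (children t))%:Z <= k)) (discrete_X HXmeas _)).
Qed.

Lemma measurable_chain v us : measurable [set w | chain (X ^~ w) v us].
Proof.
elim: us v => [|u us IH] v /=; first exact: measurable_spine.
by apply: measurable_and => //; exact: measurable_rootat.
Qed.

Lemma P_ge (n : int) : P [set w | n <= X 0 w] =
  (\esum_(k in [set: int]) (if (n <= k)%R then step P X k else 0)%:E)%E.
Proof.
pose F k := [set w | n <= k /\ X 0 w = k].
rewrite (_ : [set w | _] = \bigcup_k F k); last first.
  apply/seteqP; split=> w /=; first by exists (X 0 w).
  by move=> [k _ [nk ->]].
rewrite measure_countable_bigcup.
- apply: eq_esum => k _; rewrite /F; case: ifP => nk.
    rewrite /step fineK ?fin_num_measure //.
    by congr (P _); apply/seteqP; split=> w /= [].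
  by rewrite (_ : [set w | _] = set0) ?measure0 //; apply/seteqP; split=> w /= [].
- by move=> k; apply: measurable_and => //; exact: measurable_const.
- by move=> k l _ _ [w [[_ <-] [_ <-]]].
Qed.

(** The induction carries a word [w] already read. In the top bush the spine increment [k] is summed
    over [k >= size ts], producing the tail in [lawE]; once [k] is fixed, the bush only lengthens
    the word and the induction hypothesis covers the other bushes. *)
Lemma P_chain us v w :
  P [set o | reads (X ^~ o) v w /\ chain (X ^~ o) (v - (size w)%:Z) us] =
  (weight w * (pspine * \prod_(u <- us) law u))%:E.
Proof.
elim: us v w => [|u us IH] v w; first by rewrite big_nil mulr1 P_reads_spine.
case: u => ts; rewrite big_cons lawE.
pose W k := w ++ k :: lukf ts.
pose F k := [set o | (size ts)%:Z <= k /\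
  (reads (X ^~ o) v (W k) /\ chain (X ^~ o) (v - (size (W k))%:Z) us)].
have WE k o : reads (X ^~ o) v (W k) <-> reads (X ^~ o) v w /\
    (X (v - (size w)%:Z - 1) o = k /\
     reads (X ^~ o) (v - (size w)%:Z - 1) (lukf ts)).
  by rewrite reads_cat.
have sW k : v - (size (W k))%:Z = v - (size w)%:Z - (nverts (Node ts))%:Z.
  by rewrite size_cat /= size_lukf /fverts; lia.
rewrite (_ : [set o | _] = \bigcup_k F k); last first.
  apply/seteqP; split=> o /=.
    move=> [Rw [[sX Rf] C]]; exists (X (v - (size w)%:Z - 1) o) => //.
    by split=> //; rewrite WE sW.
  by move=> [k _ [sk]]; rewrite WE sW => -[[Rw [XE Rf]] C]; do ![split=> //]; rewrite XE.
rewrite measure_countable_bigcup.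
- have A0 : 0 <= weight w * weight (lukf ts) * (pspine * \prod_(u <- us) law u).
    rewrite !mulr_ge0 ?weight_ge0 ?pspine_ge0 //.
    by apply: prodr_ge0 => u _; exact: law_ge0.
  transitivity (\esum_(k in [set: int])
    ((weight w * weight (lukf ts) * (pspine * \prod_(u <- us) law u))%:E *
     (if ((size ts)%:Z <= k)%R then step P X k else 0)%:E))%E.
    apply: eq_esum => k _; rewrite -EFinM /F; case: ifP => sk.
      rewrite (_ : [set o | _] = [set o | reads (X ^~ o) v (W k) /\
        chain (X ^~ o) (v - (size (W k))%:Z) us]); last first.
        by apply/seteqP; split=> o /= [].
      apply: (etrans (IH v (W k))).
      rewrite /W weight_cat /weight big_cons -/(weight _); congr (_%:E); ring.
    by rewrite mulr0 (_ : [set o | _] = set0) ?measure0 //; apply/seteqP; split=> o /= [].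
  rewrite esumZl //; last first.
    by move=> k; rewrite lee_fin; case: ifP => // _; exact: step_ge0.
  rewrite -P_ge -[X in (_ * X)%E = _]fineK; last first.
    apply: fin_num_measure.
    exact: (discrete_pred (fun k => is_true ((size ts)%:Z <= k)) (discrete_X HXmeas 0)).
  by rewrite -EFinM; congr (_%:E); ring.
- move=> k; apply: measurable_and; first exact: measurable_const.
  by apply: measurable_and; [exact: measurable_reads|exact: measurable_chain].
- move=> k l _ _ [z [[_ [/WE[_ [<- _]] _]] [_ [/WE[_ [<- _]] _]]]] //.
Qed.

Lemma P_chain0 us v :
  P [set o | chain (X ^~ o) v us] = (pspine * \prod_(u <- us) law u)%:E.
Proof.
have := P_chain us v [::]; rewrite /weight big_nil mul1r => <-.
by congr (P _); apply/seteqP; split=> o /=; rewrite subr0; [split|case].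
Qed.

Lemma measurable_located m us a : measurable [set o | located (X ^~ o) m us a].
Proof.
rewrite (_ : [set o | _] = [set o | ((m < size us)%N /\ valid (nth leaf us m) a) /\
    chain (X ^~ o) (fverts (take m us) + offset (nth leaf us m) a)%N%:Z us]).
  by apply: measurable_and; [exact: measurable_const|exact: measurable_chain].
by apply/seteqP; split=> o /= [] // [].
Qed.

Lemma P_located m us a : P [set o | located (X ^~ o) m us a] =
  (if (m < size us)%N && valid (nth leaf us m) a
   then pspine * \prod_(u <- us) law u else 0)%:E.
Proof.
case: ifP => [/andP[ms va]|H]; last first.
  rewrite (_ : [set o | _] = set0) ?measure0 //; apply/seteqP; split=> // o.
  by move=> [ms va _]; rewrite ms va in H.
rewrite -(P_chain0 us (fverts (take m us) + offset (nth leaf us m) a)%N%:Z).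
by congr (P _); apply/seteqP; split=> o /=; [case|split].
Qed.
End ChainLaw.

(** * Positive drift *)

Lemma exists_height_max x n : exists2 p : nat, (p <= n)%N &
  forall l, (l <= n)%N -> height x l <= height x p.
Proof.
elim: n => [|n [p pn H]]; first by exists 0%N => // -[].
have [le|lt] := leP (height x n.+1) (height x p).
  exists p => [|l]; first by lia.
  by rewrite leq_eqVlt => /predU1P[->//|]; exact: H.
exists n.+1 => // l; rewrite leq_eqVlt => /predU1P[->//|/H ln].
exact: le_trans ln (ltW lt).
Qed.

(** A maximiser of the height on [[0, n]] also dominates the negative positions, because [n]
    does. *)
Lemma spine_exists x (n : nat) :
  (forall l : int, l < 0 -> height x l <= height x n) ->
  exists2 p : nat, (p <= n)%N & spine x p.
Proof.
move=> H; have [p pn Hp] := exists_height_max x n; exists p => // l lp.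
case: l lp => l lp; first by apply: Hp; lia.
exact: le_trans (H _ _) (Hp _ (leqnn _)).
Qed.

Section Drift.
Context (R : realType) (d : measure_display) (Omega : measurableType d)
  (P : probability Omega R) (X : int -> Omega -> int).
Hypothesis HXmeas : forall n k : int, measurable [set w | X n w = k].
Hypothesis HXval : forall n w, -1 <= X n w.
Hypothesis HXiid : forall (s : seq int) (v : int -> int), uniq s ->
  P [set w | forall i, i \in s -> X i w = v i] =
  (\prod_(i <- s) fine (P [set w | X 0 w = v i]))%:E.
Hypothesis Hmean : (0 < \int[P]_w ((X 0%R w)%:~R : R)%:E)%E.

Notation step := (step P X).

Lemma EFin_step k : (step k)%:E = P [set w | X 0 w = k].
Proof. by rewrite /step fineK // fin_num_measure. Qed.

Lemma esum_step : (\esum_(k in [set: int]) (step k)%:E = 1)%E.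
Proof.
have := P_ge P HXmeas (-1); rewrite (_ : [set w | _] = setT); last first.
  by apply/seteqP; split=> w // _; exact: HXval.
rewrite probability_setT => ->; apply: eq_esum => k _.
case: ifP => // k1; rewrite EFin_step (_ : [set w | _] = set0) ?measure0 //.
by apply/seteqP; split=> w //= E; have := HXval 0 w; rewrite E k1.
Qed.

(** The positive and negative parts are kept apart because the mean may be infinite. As increments
    are at least -1, the negative part contributes exactly the mass at -1. *)
Lemma drift_esum :
  ((step (-1))%:E < \esum_(k in [set: int]) ((Num.max k 0)%:~R * step k)%:E)%E.
Proof.
have max_ge0 (k : int) : 0 <= (Num.max k 0)%:~R :> R.
  by rewrite ler0z le_max lexx orbT.
have max_int (k : int) : Num.max (k%:~R : R) 0 = (Num.max k 0)%:~R.
  by rewrite !maxEle lerz0; case: ifP.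
have Ep : (\int[P]_w (fun w => ((X 0%R w)%:~R : R)%:E)^\+ w =
    \esum_(k in [set: int]) ((Num.max k 0)%:~R * step k)%:E)%E.
  rewrite -(integral_discrete P (discrete_X HXmeas 0) max_ge0).
  by apply: eq_integral => w _; rewrite funeposE -EFin_max max_int.
have En : (\int[P]_w (fun w => ((X 0%R w)%:~R : R)%:E)^\- w = (step (-1))%:E)%E.
  transitivity (\esum_(k in [set: int]) ((Num.max (- k) 0)%:~R * step k)%:E)%E.
    rewrite -(integral_discrete P (discrete_X HXmeas 0) (fun k => max_ge0 (- k))).
    by apply: eq_integral => w _; rewrite funenegE -EFin_max -mulrNz max_int.
  rewrite (esumID [set -1]) ?setTI; last first.
    by move=> k _; rewrite lee_fin mulr_ge0 ?step_ge0.
  rewrite esum_set1 ?lee_fin ?mulr_ge0 ?step_ge0 // esum1 ?adde0.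
    by rewrite (_ : Num.max _ _ = 1) ?mul1r.
  move=> k /= k1; have [k0|k0] := leP 0 k.
    by rewrite (_ : Num.max (- k) 0 = 0) ?mul0r //; lia.
  suff -> : step k = 0 by rewrite mulr0.
  rewrite /step (_ : [set w | _] = set0) ?measure0 //.
  by apply/seteqP; split=> w //= E; have := HXval 0 w; rewrite E; lia.
move: Hmean; rewrite integralE Ep En.
by rewrite sube_gt0.
Qed.

(* Up to a factor tending to 1 as [s] tends to 1, this bounds [s ^ k] by its
   tangent [1 - (1 - s) k], cut off at [k = M]. *)
Lemma exprz_tangent (s : R) (M : nat) (k : int) : 0 < s -> s <= 1 -> -1 <= k ->
  s ^ k + (1 - s) * s ^+ M * (if k <= M%:Z then Num.max k 0 else 0)%:~R <=
  1 + (1 - s) / s * (k == -1)%:R.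
Proof.
move=> s0 s1 k1; case: (ltP k 0) => [k0|k0].
  have -> : k = -1 by lia.
  rewrite eqxx mulr1 exprN1.
  by case: (-1 <= M%:Z); rewrite mulr0 addr0 mulrBl mul1r divff ?gt_eqF //; lra.
have -> : (k == -1) = false by lia.
rewrite mulr0 addr0; case: k k0 {k1} => // k _; rewrite -exprnP.
case: ifP => kM; last by rewrite mulr0 addr0 exprn_ile1 // ltW.
have {}kM : (k <= M)%N by lia.
elim: k kM => [|k IH] kM; first by rewrite expr0 mulr0z mulr0 addr0.
have := IH (ltnW kM); have : s ^+ M <= s ^+ k.
  by apply: ler_wiXn2l; [rewrite ltW|exact: s1|exact: ltnW].
rewrite exprSr -addn1 PoszD mulrzDr mulrDr; set a := s ^+ k; set b := s ^+ M.
by move=> ba; nra.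
Qed.
Lemma step_eq0 (k : int) : k < -1 -> step k = 0.
Proof.
move=> k1; rewrite /step (_ : [set w | _] = set0) ?measure0 //.
by apply/seteqP; split=> w //= E; have := HXval 0 w; rewrite E; lia.
Qed.

(** Averages [exprz_tangent] over the step law; restricting the positive parts to a finite set [K]
    keeps their sum finite. *)
Lemma laplace_le (s : R) (K : set int) (M : nat) : 0 < s -> s <= 1 ->
  finite_set K -> (forall k, K k -> k <= M%:Z) ->
  (\esum_(k in [set: int]) (step k * s ^ k)%:E +
   ((1 - s) * s ^+ M)%:E * \sum_(k \in K) ((Num.max k 0)%:~R * step k)%:E <=
   (1 + (1 - s) / s * step (-1))%:E)%E.
Proof.
move=> s0 s1 fK KM; pose h (k : int) : int := if k <= M%:Z then Num.max k 0 else 0.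
have h0 (k : int) : 0 <= (h k)%:~R :> R.
  by rewrite ler0z /h; case: ifP => // _; rewrite le_max lexx orbT.
have a0 : 0 <= (1 - s) * s ^+ M by rewrite mulr_ge0 ?exprn_ge0 ?subr_ge0 // ltW.
have b0 : 0 <= (1 - s) / s by rewrite divr_ge0 ?subr_ge0 // ltW.
have sX k : 0 <= step k * s ^ k.
  by rewrite mulr_ge0 ?step_ge0 // exprz_ge0 // ltW.
have st k := step_ge0 P X k.
apply: (@le_trans _ _ (\esum_(k in [set: int])
    ((step k * s ^ k)%:E + ((1 - s) * s ^+ M * (h k)%:~R * step k)%:E))%E).
  rewrite esumD => [|k _|k _]; last 2 first.
  - by rewrite lee_fin.
  - by rewrite lee_fin !mulr_ge0 // ?subr_ge0 // exprn_ge0 // ltW.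
  apply: leeD2l; apply: esum_ge; exists K; first by split.
  rewrite ge0_mule_fsumr => [|k]; last first.
    by rewrite lee_fin mulr_ge0 // ler0z le_max lexx orbT.
  by apply: lee_fsum => // k Kk; rewrite -EFinM lee_fin /h KM // mulrA.
apply: (@le_trans _ _ (\esum_(k in [set: int])
    ((step k)%:E + ((1 - s) / s * (k == -1)%:R * step k)%:E))%E).
  apply: le_esum => k _; rewrite -!EFinD lee_fin.
  have [k1|k1] := ltP k (-1); first by rewrite step_eq0 // !mul0r !mulr0 addr0.
  have := ler_wpM2r (st k) (exprz_tangent M s0 s1 k1).
  by congr (_ <= _); rewrite /h; ring.
rewrite esumD => [|k _|k _]; last 2 first.
- by rewrite lee_fin.
- by rewrite lee_fin !mulr_ge0 // ?subr_ge0 // invr_ge0 ltW.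
rewrite esum_step EFinD; apply: leeD2l.
rewrite (esumID [set -1]) ?setTI; last first.
  by move=> k _; rewrite lee_fin !mulr_ge0 // ?subr_ge0 // invr_ge0 ltW.
rewrite esum_set1 ?lee_fin ?mulr_ge0 ?subr_ge0 // ?invr_ge0 ?(ltW s0) //.
rewrite esum1 ?adde0 ?mulr1 // => k /= /eqP/negPf ->.
by rewrite mulr0 mul0r.
Qed.

Lemma bernoulli_le (e : R) n : 0 <= e -> e <= 1 -> 1 - n%:R * e <= (1 - e) ^+ n.
Proof.
move=> e0 e1; elim: n => [|n IH]; first by rewrite mul0r subr0 expr0.
have e1' : 0 <= 1 - e by rewrite subr_ge0.
rewrite exprS; apply: le_trans (ler_wpM2l e1' IH).
by rewrite -[n.+1]addn1 natrD; have : 0 <= n%:R :> R by []; nra.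
Qed.

Lemma laplace_lt1 : exists s r : R, [/\ 0 < s, s <= 1, 0 <= r, r < 1 &
  (\esum_(k in [set: int]) (step k * s ^ k)%:E <= r%:E)%E].
Proof.
(* The sum of positive parts is a supremum of finite sums, so a finite set [K] already beats the
   mass at -1. *)
have [_ [K [fK _] <-]] := ereal_sup_gt drift_esum.
rewrite fsbig_finite //= sumEFin lte_fin; set A := \sum_(k <- _) _ => bA.
set b := step (-1) in bA; have b0 : 0 <= b by exact: step_ge0.
pose M := (\max_(k <- finmap.enum_fset (fset_set K)) absz k)%N.
have KM k : K k -> k <= M%:Z.
  move=> Kk; have : (absz k <= M)%N.
    by apply: (@leq_bigmax_seq _ _ _ (fun k : int => absz k)); rewrite ?in_fset_set ?inE.
  by lia.
have A0 : 0 < A by exact: le_lt_trans bA.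
(* With this [e], [M.+1 * e * A] is half of the gap [A - b], so Bernoulli's inequality keeps
   [s ^+ M.+1 * A] above [b]. *)
pose e := (A - b) / (2 * A * M.+1%:R).
have n1 : 1 <= M.+1%:R :> R by rewrite ler1n.
have An : 0 < 2 * A * M.+1%:R by rewrite !mulr_gt0.
have e0 : 0 < e by rewrite divr_gt0 ?subr_gt0.
have ee : e * (2 * A * M.+1%:R) = A - b by rewrite divfK ?gt_eqF.
have e1 : e < 1.
  rewrite /e ltr_pdivrMr // mul1r; nra.
pose s := 1 - e; have s0 : 0 < s by rewrite /s; lra.
have s1 : s <= 1 by rewrite /s; lra.
have sA : b < s ^+ M.+1 * A.
  apply: (@lt_le_trans _ _ ((1 - M.+1%:R * e) * A)); first by nra.
  by rewrite ler_wpM2r ?bernoulli_le // ltW.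
(* The bound left by [laplace_le]; [r < 1] amounts to [b / s < s ^+ M * A]. *)
pose r := 1 + (1 - s) / s * b - (1 - s) * s ^+ M * A.
have Hr : (\esum_(k in [set: int]) (step k * s ^ k)%:E <= r%:E)%E.
  rewrite /r EFinB leeBrDr //; have := laplace_le s0 s1 fK KM.
  by rewrite fsbig_finite //= sumEFin.
exists s, r; split=> //.
  rewrite -lee_fin; apply: le_trans Hr; apply: esum_ge0 => k _.
  by rewrite lee_fin mulr_ge0 ?step_ge0 // exprz_ge0 // ltW.
have E : (1 - s) / s * b = (1 - s) * (b / s) by rewrite mulrAC mulrA.
rewrite /r E -[X in _ < X]subr0 -addrA ltrD2l -opprB ltrN2 -mulrA -mulrBr.
rewrite mulr_gt0 ?subr_gt0 //; first by rewrite /s; lra.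
by rewrite ltr_pdivrMr // mulrAC -exprSr.
Qed.
End Drift.

(** * Almost sure existence of spine points *)

Section SpineExists.
Import numFieldNormedType.Exports.
Context (R : realType) (d : measure_display) (Omega : measurableType d)
  (P : probability Omega R) (X : int -> Omega -> int).
Hypothesis HXmeas : forall n k : int, measurable [set w | X n w = k].
Hypothesis HXval : forall n w, -1 <= X n w.
Hypothesis HXiid : forall (s : seq int) (v : int -> int), uniq s ->
  P [set w | forall i, i \in s -> X i w = v i] =
  (\prod_(i <- s) fine (P [set w | X 0 w = v i]))%:E.
Hypothesis Hmean : (0 < \int[P]_w ((X 0%R w)%:~R : R)%:E)%E.

Notation step := (step P X).

Definition sum_le (m : int) (u : seq int) : bool := \sum_(k <- u) k <= m.

Lemma sum_le_mass0 (s : R) m : 0 < s -> s <= 1 ->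
  (seg_mass P X 0 (sum_le m) <= (s ^ (- m))%:E)%E.
Proof.
move=> s0 s1; rewrite -(P_seg_mass HXmeas HXiid _ _ (@back_inj 0)).
rewrite (_ : [set o | _] = [set _ | 0 <= m]); last first.
  by apply/seteqP; split=> o; rewrite /= /sum_le big_nil.
case: (leP 0 m) => m0; last first.
  rewrite (_ : [set _ | _] = set0) ?measure0 ?lee_fin ?exprz_ge0 ?ltW //.
  by apply/seteqP; split.
apply: le_trans (probability_le1 P _) _; first exact: measurable_const.
case: m m0 => // m _; rewrite lee_fin -exprnN invf_ge1 ?exprn_gt0 //.
by rewrite exprn_ile1 // ltW.
Qed.

Lemma sum_le_massS n m : seg_mass P X n.+1 (sum_le m) =
  (\esum_(k in [set: int]) ((step k)%:E * seg_mass P X n (sum_le (m - k))))%E.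
Proof.
rewrite -(P_seg_mass HXmeas HXiid _ _ (@back_inj 0)).
pose F k := [set o | seg (X ^~ o) (back 0) (size [:: k]) = [:: k] /\
  sum_le (m - k) (seg (X ^~ o) (back 0 \o addn (size [:: k])) n)].
rewrite (_ : [set o | _] = \bigcup_k F k); last first.
  have E o : sum_le m (seg (X ^~ o) (back 0) n.+1) =
     sum_le (m - X (back 0 0) o) (seg (X ^~ o) (back 0 \o addn 1) n).
    by rewrite -[n.+1]add1n seg_add /sum_le big_cat /= big_seq1 lerBrDl.
  apply/seteqP; split=> o /=; first by rewrite E; exists (X (back 0 0) o).
  by move=> [k _ []]; rewrite E {1}/seg /= => -[->].
rewrite measure_countable_bigcup.
- apply: eq_esum => k _.
  apply: (etrans (P_seg_split HXmeas HXiid [:: k] n (sum_le (m - k)) (@back_inj 0))).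
  by rewrite /weight big_seq1.
- move=> k; apply: measurable_and; first exact: discrete_seg.
  exact: (discrete_pred (fun u => is_true (sum_le (m - k) u)) (discrete_seg HXmeas _ _)).
- by move=> k l _ _ [z [[[<-] _] [[<-] _]]].
Qed.

(** Exponential Markov bound, proved by conditioning on the first letter, so that each step costs
    one factor [r]. *)
Lemma chernoff (s r : R) n m : 0 < s -> s <= 1 -> 0 <= r ->
  (\esum_(k in [set: int]) (step k * s ^ k)%:E <= r%:E)%E ->
  (seg_mass P X n (sum_le m) <= (r ^+ n * s ^ (- m))%:E)%E.
Proof.
move=> s0 s1 r0 Hr; elim: n m => [|n IH] m.
  by rewrite expr0 mul1r; exact: sum_le_mass0.
rewrite sum_le_massS.
have c0 : 0 <= r ^+ n * s ^ (- m).
  by rewrite mulr_ge0 ?exprn_ge0 // exprz_ge0 // ltW.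
have st k := step_ge0 P X k.
apply: (@le_trans _ _ (\esum_(k in [set: int])
    ((r ^+ n * s ^ (- m))%:E * (step k * s ^ k)%:E))%E).
  apply: le_esum => k _; apply: (@le_trans _ _ ((step k)%:E * (r ^+ n * s ^ (- (m - k)))%:E)%E).
    by rewrite lee_wpmul2l ?lee_fin.
  rewrite -!EFinM lee_fin opprB addrC expfzDr ?gt_eqF //.
  by rewrite le_eqVlt; apply/orP; left; apply/eqP; ring.
rewrite esumZl // => [|k]; last by rewrite lee_fin mulr_ge0 // exprz_ge0 // ltW.
apply: le_trans (lee_wpmul2l _ Hr) _; first by rewrite lee_fin.
by rewrite -EFinM lee_fin exprSr mulrAC.
Qed.

Lemma geometric_le (r : R) : 0 <= r -> r < 1 ->
  (\sum_(j <oo) (r ^+ j)%:E <= ((1 - r)^-1)%:E)%E.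
Proof.
move=> r0 r1; apply: lime_le.
  by apply: is_cvg_nneseries => j _ _; rewrite lee_fin exprn_ge0.
apply: nearW => n; rewrite sumEFin lee_fin -[_^-1]mul1r ler_pdivlMr ?subr_gt0 //.
elim: n => [|n IH]; first by rewrite big_geq // mul0r.
suff E : forall n, (\sum_(0 <= j < n) r ^+ j) * (1 - r) = 1 - r ^+ n.
  by rewrite E lerBlDr lerDl exprn_ge0.
elim=> [|k IHk]; first by rewrite big_geq // mul0r expr0 subrr.
by rewrite big_nat_recr //= mulrDl IHk exprSr; ring.
Qed.

Lemma P_no_spine : P [set o | forall p : nat, ~ spine (X ^~ o) p] = 0%E.
Proof.
have [s [r [s0 s1 r0 r1 Hr]]] := laplace_lt1 HXmeas HXval Hmean.
set N0 := [set o | _].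
have mN0 : measurable N0.
  apply: measurable_all => p; apply: measurable_imp; last exact: measurable_const.
  exact: measurable_spine.
(* Without a spine point in [[0, N]] some [l < 0] is strictly higher than [N], so a backward sum
   from [N] of length at least [N.+1] is negative. The Chernoff bounds are summed over these
   lengths. *)
have bound N : (P N0 <= (r ^+ N.+1 * (s * (1 - r)^-1))%:E)%E.
  pose F j := [set o | sum_le (-1) (seg (X ^~ o) (back N) (N.+1 + j))].
  apply: (@le_trans _ _ (\sum_(j <oo) P (F j))%E).
    apply: measure_sigma_subadditive => //.
      move=> j; exact: (discrete_pred (fun u => is_true (sum_le (-1) u)) (discrete_seg HXmeas _ _)).
    move=> o No; apply: contrapT => nF; have [|p _ sp] := @spine_exists (X ^~ o) N; last exact: (No p).
    move=> l l0; rewrite leNgt; apply/negP => hl; apply: nF.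
    exists (absz l).-1 => //; rewrite /F /mkset /sum_le big_seg (sum_back (X ^~ o)).
    have -> : N%:Z - (N.+1 + (absz l).-1)%N%:Z = l by lia.
    by move: hl; move: (height _ l) (height _ N) => a b; lia.
  apply: (@le_trans _ _ (\sum_(j <oo) ((r ^+ N.+1 * s)%:E * (r ^+ j)%:E))%E).
    apply: lee_nneseries => [j _ _|j _]; first exact: measure_ge0.
    rewrite /F (P_seg_mass HXmeas HXiid _ _ (@back_inj N)).
    apply: le_trans (chernoff _ _ s0 s1 r0 Hr) _.
    by rewrite opprK expr1z -EFinM lee_fin exprD mulrAC.
  rewrite nneseriesZl => [|j _]; last by rewrite lee_fin exprn_ge0.
  rewrite mulrA [leRHS]EFinM; apply: lee_wpmul2l; last exact: geometric_le.
  by rewrite lee_fin mulr_ge0 ?exprn_ge0 // ltW.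
apply/eqP; rewrite eq_le measure_ge0 andbT.
rewrite -[P N0]fineK ?fin_num_measure // lee_fin.
set C := s * (1 - r)^-1 in bound.
have cv : (fun N => r ^+ N.+1 * C) @ \oo --> (0 : R).
  rewrite -[0](mul0r C); apply: cvgMr_tmp.
  rewrite (cvg_shiftS (fun N => r ^+ N)); apply: cvg_expr.
  by rewrite ger0_norm.
rewrite -(cvg_lim _ cv) //; apply: limr_ge; first by apply/cvg_ex; exists 0.
apply: nearW => N; rewrite -lee_fin fineK ?fin_num_measure //.
Qed.
End SpineExists.

(** * Mass of the located events *)

Section RandomGraph.
Context (d : measure_display) (T : measurableType d) (V : countType)
  (pr lt : T -> V -> V -> Prop).
Hypothesis mpr : forall u v, measurable [set w | pr w u v].
Hypothesis mlt : forall u v, measurable [set w | lt w u v].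

Lemma measurable_within r u v : measurable [set w | Defs.within (pr w) r u v].
Proof.
elim: r u => [|r IH] u /=; first exact: measurable_const.
apply: measurable_or; first exact: measurable_const.
by apply: measurable_ex => z; apply: measurable_and => //; exact: measurable_or.
Qed.

Lemma measurable_ball_iso r root n (F : fshape n) :
  measurable [set w | ball_iso (pr w) (lt w) r root F].
Proof.
(* Finite functions form a countable type, so the existential becomes a countable union. *)
rewrite (_ : [set w | _] = [set w | exists f : {ffun 'I_n -> V},
    (injective f /\ f (Defs.froot F) = root) /\
    ((forall v, Defs.within (pr w) r root v <-> exists i, f i = v) /\
     ((forall i j, fpar F i = Some j <-> pr w (f i) (f j)) /\
      (forall i j, flt F i j <-> lt w (f i) (f j))))]); last first.
  apply/seteqP; split=> w /= [f].
    move=> [finj fr fb fp fl]; exists [ffun i => f i].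
    split; first by split; [move=> i j; rewrite !ffunE => /finj | rewrite ffunE].
    split; first by move=> v; rewrite fb; split=> -[i <-]; exists i; rewrite ffunE.
    by split=> i j; rewrite !ffunE.
  by move=> [[finj fr] [fb [fp fl]]]; exists f.
apply: measurable_ex => f; apply: measurable_and; first exact: measurable_const.
apply: measurable_and.
  apply: measurable_all => v; apply: measurable_iff; first exact: measurable_within.
  exact: measurable_const.
apply: measurable_and; apply: measurable_all => i; apply: measurable_all => j;
  apply: measurable_iff => //; exact: measurable_const.
Qed.
End RandomGraph.

(** * Restriction of the family of trees to a finite window *)

Lemma ektpr_agree (tr tr' : int -> ptree) u v : tr u.1 = tr' u.1 ->
  ektpr tr u v -> ektpr tr' u v.
Proof. by rewrite /ektpr => ->. Qed.

(** A ball of radius [r < s] around a vertex of the tree 0 stays among the trees of index at most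
    [s] in absolute value; the local transfer is applied to the identity. *)
Lemma ekt_ball_iso_agree (s : nat) (tr tr' : int -> ptree) a r n (F : fshape n) :
  (r < s)%N -> (forall i : int, `|i| <= s%:Z -> tr i = tr' i) -> valid (tr 0) a ->
  ball_iso (ektpr tr') (ektlt tr') r (0, a) F <->
  ball_iso (ektpr tr) (ektlt tr) r (0, a) F.
Proof.
move=> rs E va.
have s0 : 0 <= s%:Z by [].
have W n0 u : in_window s%:Z tr n0 u <-> in_window s%:Z tr' n0 u.
  by split=> -[us]; [rewrite E|rewrite -E]; try lia; split.
have W0 n0 u : in_window s%:Z tr n0 u -> tr u.1 = tr' u.1.
  by move=> [us _]; apply: E; lia.
have pradj u w : in_window s%:Z tr 1 u ->
    adj (ektpr tr) u w <-> adj (ektpr tr') u w.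
  move=> Du; split=> uw.
    have Dw := ektpr_window s0 Du uw.
    by case: uw => [/(ektpr_agree (W0 _ _ Du))|/(ektpr_agree (W0 _ _ Dw))]; [left|right].
  have /W Dw := ektpr_window s0 ((W _ _).1 Du) uw.
  by case: uw => [/(ektpr_agree (esym (W0 _ _ Du)))|/(ektpr_agree (esym (W0 _ _ Dw)))]; [left|right].
have prE u w : in_window s%:Z tr 1 u -> ektpr tr' u w <-> ektpr tr u w.
  by move=> /W0 Eu; split; exact: ektpr_agree.
apply: (@local_ball_iso _ _ _ _ _ _ (in_window s%:Z tr) id).
- by move=> k u [us vu]; split=> //; lia.
- by move=> k u w; exact: ektpr_window.
- by move=> u w Du /(pradj _ _ Du).
- by move=> u j Du /(pradj _ _ Du) uj; exists j.
- by [].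
- by move=> u w Du _; exact: prE.
- move=> u w Du Dw; split=> -[p [up wp lt]]; exists p; split=> //;
    by [apply/(prE _ _ Du)|apply/(prE _ _ Dw)].
- by split=> //=; lia.
Qed.

(** Only the values with [|i| <= s] carry information. *)
Definition tree_at (s : nat) (us : seq ptree) (i : int) : ptree :=
  nth leaf us (absz (s%:Z - i)%R).

Lemma tree_windowK s us : size us = s.*2.+1 -> tree_window s (tree_at s us) = us.
Proof.
move=> su; apply: (@eq_from_nth _ leaf); rewrite size_mkseq // => j js.
by rewrite nth_mkseq // /tree_at; congr nth; lia.
Qed.

Lemma tree_atK (s : nat) (tr : int -> ptree) (i : int) : `|i| <= s%:Z ->
  tree_at s (tree_window s tr) i = tr i.
Proof. by move=> is_; rewrite /tree_at nth_mkseq; [congr tr|]; lia. Qed.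

Section Mass.
Context (R : realType) (d : measure_display) (Omega : measurableType d)
  (P : probability Omega R) (X : int -> Omega -> int).
Hypothesis HXmeas : forall n k : int, measurable [set w | X n w = k].
Hypothesis HXiid : forall (s : seq int) (v : int -> int), uniq s ->
  P [set w | forall i, i \in s -> X i w = v i] =
  (\prod_(i <- s) fine (P [set w | X 0 w = v i]))%:E.
Hypothesis Hm1 : (0 < P [set w | X 0%R w = (-1)%R])%E.
Context (d' : measure_display) (Omega' : measurableType d')
  (Q : probability Omega' R) (Tr : int -> Omega' -> ptree).
Hypothesis HTmeas : forall (i : int) (t : ptree), measurable [set w | Tr i w = t].
Hypothesis HTiid : forall (s : seq int) (ts : int -> ptree), uniq s ->
  Q [set w | forall i, i \in s -> Tr i w = ts i] =
  (\prod_(i <- s) ekt_root_law (pibar P X) (pitilde P X) (ts i))%:E.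

Notation law := (ekt_root_law (pibar P X) (pitilde P X)).
Notation pspine := (pspine P X).

Lemma measurable_recpr i j : measurable [set w | recpr (X ^~ w) i j].
Proof.
have my k l (S : int -> Prop) : measurable [set w | S (ysum (X ^~ w) k l)].
  rewrite (_ : [set w | _] = [set w |
      S (\sum_(z <- seg (X ^~ w) (fun m => k + m%:Z) (absz (l - k)%R)) z)]).
    exact: (discrete_pred (fun u => S (\sum_(z <- u) z)) (discrete_seg HXmeas _ _)).
  by apply/seteqP; split=> w /=; rewrite /ysum big_mkord big_seg.
rewrite (_ : [set w | _] = [set w | i < j /\ (0 <= ysum (X ^~ w) i j /\
   forall n, i < n -> n < j -> ysum (X ^~ w) i n < 0)]); last first.
  by apply/seteqP; split=> w /= [] // ? [].
apply: measurable_and; first exact: measurable_const.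
apply: measurable_and; first exact: (my _ _ (fun y => is_true (0 <= y))).
apply: measurable_all => n; do 2![apply: measurable_imp; first exact: measurable_const].
exact: (my _ _ (fun y => is_true (y < 0))).
Qed.

Lemma measurable_reclt i j : measurable [set w | reclt (X ^~ w) i j].
Proof.
rewrite (_ : [set w | _] = [set w | exists p,
   recpr (X ^~ w) i p /\ (recpr (X ^~ w) j p /\ i < j)]).
  apply: measurable_ex => p; apply: measurable_and; first exact: measurable_recpr.
  by apply: measurable_and; [exact: measurable_recpr|exact: measurable_const].
apply/seteqP; split=> w /= [p]; first by case=> *; exists p.
by move=> [? [? ?]]; exists p.
Qed.

Lemma discrete_window s : discrete (fun w => tree_window s (Tr ^~ w)).
Proof. by apply: discrete_mkseq => j t; exact: HTmeas. Qed.

Lemma Q_window s us : fine (Q [set w | tree_window s (Tr ^~ w) = us]) =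
  if size us == s.*2.+1 then \prod_(u <- us) law u else 0.
Proof.
case: eqP => su; last first.
  rewrite (_ : [set w | _] = set0) ?measure0 //; apply/seteqP; split=> w //= E.
  by case: su; rewrite -E size_mkseq.
pose idx := mkseq (fun j => s%:Z - j%:Z) s.*2.+1.
have uidx : uniq idx by rewrite map_inj_uniq ?iota_uniq // => j k; lia.
rewrite (_ : [set w | _] = [set w | forall i, i \in idx -> Tr i w = tree_at s us i]).
  by rewrite HTiid // -[in RHS](tree_windowK su) /= !big_map.
apply/seteqP; split=> w /=.
  by move=> <- i /mapP[j]; rewrite mem_iota => js ->; rewrite tree_atK //; lia.
move=> H; rewrite -[RHS](tree_windowK su); apply/eq_in_map => j js.
by apply: H; apply/mapP; exists j.
Qed.

(* The event that 0 lies in the middle one of [2s + 1] decoded consecutive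
   bushes [us], at an address [a] with [G us a]. *)
Definition located_in (s : nat) (G : seq ptree -> pred (seq nat)) : set Omega :=
  \bigcup_(p : seq ptree * seq nat)
    [set w | (size p.1 = s.*2.+1 /\ G p.1 p.2) /\ located (X ^~ w) s p.1 p.2].

(** Disjointness turns the probability into a sum over bushes and addresses. Each term is [pspine]
    times the law of the window; summing over addresses gives the count, and summing over windows
    gives the integral. *)
Lemma P_located_in s (G : seq ptree -> pred (seq nat)) :
  P (located_in s G) = (pspine%:E *
    \int[Q]_w ((count (G (tree_window s (Tr ^~ w))) (addrs (Tr 0 w)))%:R : R)%:E)%E.
Proof.
pose g us : R := (count (G us) (addrs (nth leaf us s)))%:R.
rewrite [X in (_ * X)%E](_ : _ = (\int[Q]_w (g (tree_window s (Tr ^~ w)))%:E)%E); last first.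
  apply: eq_integral => w _; rewrite /g nth_mkseq ?subrr //; lia.
rewrite (integral_discrete Q (discrete_window s)) => [|us]; last exact: ler0n.
have law0 us : 0 <= \prod_(u <- us) law u.
  by apply: prodr_ge0 => u _; exact: law_ge0.
have m0 us : 0 <= if size us == s.*2.+1 then \prod_(u <- us) law u else 0.
  by case: ifP.
have q0 : 0 <= pspine by exact: pspine_ge0.
rewrite -esumZl // => [|us]; last by rewrite lee_fin Q_window mulr_ge0 // ler0n.
rewrite /located_in measure_countable_bigcup.
- rewrite (_ : [set: seq ptree * seq nat] = [set: seq ptree] `*`` (fun=> [set: seq nat])); last first.
    by apply/seteqP; split.
  rewrite -(@esum_esum _ _ _ _ _ (fun us a => P [set w |
    (size us = s.*2.+1 /\ G us a) /\ located (X ^~ w) s us a])) //.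
  apply: eq_esum => us _; rewrite Q_window.
  transitivity (\esum_(a in [set: seq nat])
     ((pspine * if size us == s.*2.+1 then \prod_(u <- us) law u else 0)%:E *
      (((a \in addrs (nth leaf us s)) && G us a)%:R)%:E))%E.
    apply: eq_esum => a _; rewrite mem_addrs -EFinM; case: eqP => su; last first.
      rewrite mulr0 mul0r (_ : [set w | _] = set0) ?measure0 //.
      by apply/seteqP; split=> w //= -[[]].
    case Ga : (G us a); last first.
      rewrite andbF mulr0 (_ : [set w | _] = set0) ?measure0 //.
      by apply/seteqP; split=> w //= -[[]].
    rewrite (_ : [set w | _] = [set w | located (X ^~ w) s us a]); last first.
      by apply/seteqP; split=> w /=; [case|].
    rewrite P_located // su (_ : (s < s.*2.+1)%N) /=; last by lia.
    by rewrite andbT; case: ifP => _; rewrite ?mulr1 ?mulr0.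
  rewrite esumZl ?mulr_ge0 //.
  rewrite esum_count ?addrs_uniq // -!EFinM /g; congr (_%:E).
  by rewrite -mulrA [X in _ * X]mulrC.
- move=> p; apply: measurable_and; first exact: measurable_const.
  exact: measurable_located.
- move=> [us a] [us' a'] _ _ [z [[[/= su _] /= L] [[/= su' _] /= L']]].
  by have [-> ->] := located_inj (etrans su (esym su')) L L'.
Qed.

(** The mass is read off from the realisation: the events [Tr 0 w = t] partition [Omega']. *)
Lemma esum_law : (\esum_(t in [set: ptree]) (law t)%:E = 1)%E.
Proof.
rewrite -(probability_setT Q) (_ : setT = \bigcup_t [set w | Tr 0 w = t]); last first.
  by apply/seteqP; split=> w // _; exists (Tr 0 w).
rewrite measure_countable_bigcup => //; last by move=> t t' _ _ [w [<- <-]].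
apply: eq_esum => t _; have := HTiid (s := [:: 0]) (fun=> t) isT.
rewrite big_seq1 => <-; congr (Q _); apply/seteqP; split=> w /= H; last first.
  by move=> i; rewrite inE => /eqP ->.
by apply: H; rewrite inE.
Qed.

(** The decoding events are disjoint parts of the spine event, and their probabilities add up to
    [pspine] times the total mass 1, the whole probability of that event. *)
Lemma P_spine_undecoded (p : int) :
  P [set w | spine (X ^~ w) p /\ ~ exists t, chain (X ^~ w) p [:: t]] = 0%E.
Proof.
pose D := \bigcup_t [set w | chain (X ^~ w) p [:: t]].
have mC t : measurable [set w | chain (X ^~ w) p [:: t]] by exact: measurable_chain.
have PD : P D = pspine%:E.
  rewrite measure_countable_bigcup //.
    rewrite -[RHS]mule1 -esum_law -esumZl ?pspine_ge0 //; last first.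
      by move=> t; rewrite lee_fin law_ge0.
    apply: eq_esum => t _.
    by apply: (etrans (P_chain0 HXmeas HXiid Hm1 [:: t] p)); rewrite big_seq1.
  by move=> t t' _ _ [w [C C']]; have [] := chain_inj (erefl : size [:: t] = size [:: t']) C C'.
have mD : measurable D by apply: countable_bigcupT_measurable => //; exact: countableP.
rewrite (_ : [set w | _] = [set w | spine (X ^~ w) p] `\` D); last first.
  apply/seteqP; split=> w [sp nD]; split=> //; first by move=> [t _ C]; apply: nD; exists t.
  by move=> [t C]; apply: nD; exists t.
rewrite measureD //; last first.
- exact: le_lt_trans (probability_le1 P (measurable_spine HXmeas p)) (ltry _).
- exact: measurable_spine.
have DE : [set w | spine (X ^~ w) p] `&` D = D.
  apply/seteqP; split=> w [] // t _ C; split; last by exists t.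
  exact: (chain_spine C).
transitivity (pspine%:E - pspine%:E)%E; last by rewrite subee.
congr (_ - _)%E; last by rewrite DE.
by have := P_chain0 HXmeas HXiid Hm1 [::] p; rewrite big_nil mulr1.
Qed.

Hypothesis HXval : forall n w, -1 <= X n w.
Hypothesis Hmean : (0 < \int[P]_w ((X 0%R w)%:~R : R)%:E)%E.

(** Off a null set there is a least spine point [p >= 0] and its bush is decoded. The bush ends at
    another spine point, which is negative by minimality, so it contains 0. *)
Lemma P_located_bush : P (located_in 0 (fun _ _ => true)) = 1%E.
Proof.
set U := located_in _ _.
have mU : measurable U.
  apply: countable_bigcupT_measurable; first exact: countableP.
  move=> p; apply: measurable_and; first exact: measurable_const.
  exact: measurable_located.
pose N0 := [set w | forall p : nat, ~ spine (X ^~ w) p].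
pose N (p : nat) := [set w | spine (X ^~ w) p /\ ~ exists t, chain (X ^~ w) p [:: t]].
have mN0 : measurable N0.
  apply: measurable_all => p; apply: measurable_imp; last exact: measurable_const.
  exact: measurable_spine.
have mN p : measurable (N p).
  apply: measurable_and; first exact: measurable_spine.
  apply: measurable_imp; last exact: measurable_const.
  by apply: measurable_ex => t; exact: measurable_chain.
have sub : ~` U `<=` N0 `|` \bigcup_p N p.
  move=> w nU; apply: contrapT => /not_orP[nN0 nN]; apply: nU.
  have ex : exists p : nat, `[< spine (X ^~ w) p >].
    by apply: contrapT => H; apply: nN0 => p sp; apply: H; exists p; exact/asboolP.
  case: (ex_minnP ex) => p /asboolP sp pmin.
  have [t C] : exists t, chain (X ^~ w) p [:: t].
    by apply: contrapT => H; apply: nN; exists p.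
  have [Rt sp'] := C.
  have lt0 : p%:Z - (nverts t)%:Z < 0.
    rewrite ltNge; apply/negP => ge0; have g := nverts_gt0 t.
    have /pmin : `[< spine (X ^~ w) (absz (p%:Z - (nverts t)%:Z)%R) >].
      by apply/asboolP; rewrite gez0_abs.
    by lia.
  have [|a va ap] := @offset_surj t p; first lia.
  exists ([:: t], a) => //; split=> //; split=> //=.
  by rewrite ap.
have PU : P (~` U) = 0%E.
  apply/eqP; rewrite -measure_le0; apply: (@le_trans _ _ (P (N0 `|` \bigcup_p N p))).
    apply: le_measure => //; rewrite inE; first exact: measurableC.
    by apply: measurableU => //; exact: bigcupT_measurable.
  rewrite measure_le0; apply/eqP/null_set_setU => //; first exact: bigcupT_measurable.
    exact: P_no_spine.
  apply/eqP; rewrite -measure_le0.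
  apply: le_trans (measure_sigma_subadditive P mN _ (@subset_refl _ _)) _.
    exact: bigcupT_measurable.
  by rewrite eseries0 // => p _ _; exact: P_spine_undecoded.
by rewrite -[U]setCK probability_setC ?PU ?sube0 //; exact: measurableC.
Qed.
End Mass.

(** The equation [q * S = 1] forces [q] to be positive and [S] finite, with inverse [q]; finiteness
    of [q * I] then makes [I] finite. *)
Lemma fine_mule_normalized (R : realType) (q : R) (S I : \bar R) :
  0 <= q -> (0 <= S)%E -> (0 <= I)%E -> (q%:E * S = 1)%E ->
  (q%:E * I < +oo)%E -> fine (q%:E * I)%E = fine I / fine S.
Proof.
rewrite le_eqVlt => /predU1P[<- _ _|q0].
  by rewrite mul0e => -[] /eqP; rewrite eq_sym oner_eq0.
case: S => [s||] //; last by rewrite gt0_muley ?lte_fin.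
case: I => [i||] //; last by rewrite gt0_muley ?lte_fin // ltxx.
move=> _ _ [qs] _ /=; have s0 : s != 0.
  by apply/eqP => E; move/eqP: qs; rewrite E mulr0 eq_sym oner_eq0.
by apply: (mulIf s0); rewrite divfK // mulrAC qs mul1r.
Qed.

Theorem theorem4p22 (R : realType)
  (d : measure_display) (Omega : measurableType d) (P : probability Omega R)
  (X : int -> Omega -> int)
  (HXmeas : forall (n k : int), measurable [set w | X n w = k])
  (HXval : forall n w, -1 <= X n w)
  (HXiid : forall (s : seq int) (v : int -> int), uniq s ->
     P [set w | forall i, i \in s -> X i w = v i] =
     (\prod_(i <- s) fine (P [set w | X 0 w = v i]))%:E)
  (Hm1 : (0 < P [set w | X 0%R w = (-1)%R])%E)
  (Hmean : (0 < \int[P]_w ((X 0%R w)%:~R : R)%:E)%E)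
  (d' : measure_display) (Omega' : measurableType d') (Q : probability Omega' R)
  (Tr : int -> Omega' -> ptree)
  (HTmeas : forall (i : int) (t : ptree), measurable [set w | Tr i w = t])
  (HTiid : forall (s : seq int) (ts : int -> ptree), uniq s ->
     Q [set w | forall i, i \in s -> Tr i w = ts i] =
     (\prod_(i <- s) ekt_root_law (pibar P X) (pitilde P X) (ts i))%:E) :
  forall (r n : nat) (F : fshape n),
    fine (P [set w | ball_iso (recpr (X ^~ w)) (reclt (X ^~ w)) r 0 F]) =
    fine (\int[Q]_w ((count (fun a => `[< ball_iso (ektpr (Tr ^~ w)) (ektlt (Tr ^~ w))
                                              r (0, a) F >])
                           (addrs (Tr 0 w)))%:R : R)%:E)
    / fine (\int[Q]_w ((size (addrs (Tr 0 w)))%:R : R)%:E).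
Proof.
move=> r n F.
(* Expressed through the finite list [us]; half-width [r.+1] keeps balls of radius [r] away from the
   ends of the window. *)
pose good us (a : seq nat) := `[< ball_iso (ektpr (tree_at r.+1 us))
  (ektlt (tree_at r.+1 us)) r (0, a) F >].
pose A := [set w | ball_iso (recpr (X ^~ w)) (reclt (X ^~ w)) r 0 F].
set I := (X in fine X / _); set S := (X in _ / fine X).
(* The mass is the same for every [s], so the value 1 found for a single bush also shows that the
   wide windows cover almost surely. *)
have massT s : P (located_in X s (fun _ _ => true)) = ((pspine P X)%:E * S)%E.
  by rewrite (P_located_in HXmeas HXiid Hm1 HTmeas HTiid) /S; congr (_ * _)%E.
have qS : ((pspine P X)%:E * S = 1)%E.
  by rewrite -(massT 0%N); exact: (P_located_bush HXmeas HXiid Hm1 HTmeas HTiid HXval Hmean).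
have massG : P (located_in X r.+1 good) = ((pspine P X)%:E * I)%E.
  rewrite (P_located_in HXmeas HXiid Hm1 HTmeas HTiid) /I; congr (_ * _)%E.
  apply: eq_integral => w _; congr (_%:R%:E); apply: eq_in_count => a.
  rewrite mem_addrs => va; apply: asbool_equiv_eq.
  by apply: (@ekt_ball_iso_agree r.+1) => // i ir; rewrite tree_atK.
have mU G : measurable (located_in X r.+1 G).
  apply: countable_bigcupT_measurable => [|p]; first exact: countableP.
  by apply: measurable_and; [exact: measurable_const|exact: measurable_located].
have mA : measurable A.
  by apply: measurable_ball_iso => i j; [exact: measurable_recpr|exact: measurable_reclt].
have AU : A `&` located_in X r.+1 (fun _ _ => true) = located_in X r.+1 good.
  have iso w us a : size us = r.+1.*2.+1 -> located (X ^~ w) r.+1 us a ->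
      A w <-> good us a.
    move=> su L; rewrite -{1}(tree_windowK su) in L.
    by rewrite /A /= (located_ball_iso F (ltnSn r) L); split=> /asboolP.
  apply/seteqP; split=> w.
    move=> [Aw [[us a] _ /= [[su _] L]]]; exists (us, a) => //=.
    by split=> //; split=> //; apply/(iso w).
  move=> [[us a] _ /= [[su Ba] L]]; split; last by exists (us, a).
  exact/(iso w us a su L).
have PA : P A = ((pspine P X)%:E * I)%E.
  rewrite -massG -AU (measureDI P mA (mU (fun _ _ => true))).
  (* The rest of [A] lies in the complement of the located event, a null set. *)
  rewrite [X in (X + _)%E](_ : _ = 0%E) ?add0e //; apply/eqP; rewrite -measure_le0.
  apply: (@le_trans _ _ (P (~` located_in X r.+1 (fun _ _ => true)))).
    apply: le_measure; rewrite ?inE; [exact: measurableD|exact: measurableC|].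
    by move=> w [].
  by rewrite probability_setC // massT qS subee.
rewrite -/A PA; apply: fine_mule_normalized => //.
- exact: pspine_ge0.
- by apply: integral_ge0 => w _; rewrite lee_fin ler0n.
- by apply: integral_ge0 => w _; rewrite lee_fin ler0n.
- by rewrite -PA; exact: le_lt_trans (probability_le1 P mA) (ltry _).
Qed.
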